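(* Let $k$ be an algebraically closed field of characteristic zero and let $G$ be a finite group. If $\mathcal{B}(G)=\{1\}$, then $\mathrm{H}^2_\ell(G)\cong \mathrm{Int}_k(G)/\mathrm{Inn}(G)$ as groups.
   Context: $k[G]$ is the group algebra with coproduct $\Delta(g)=g\otimes g$ for $g\in G$. A twist on $k[G]$ is an invertible element $F\in k[G]\otimes k[G]$ with $(F\otimes 1)(\Delta\otimes\mathrm{id})(F)=(1\otimes F)(\mathrm{id}\otimes\Delta)(F)$. It is invariant if $\Delta(a)F=F\Delta(a)$ for all $a\in k[G]$. Invariant twists form a group $Z^2$ under multiplication. For $a$ in the group $A^1$ of invertible central elements of $k[G]$ put $\delta^1(a)=(a\otimes a)\Delta(a^{-1})$; $\delta^1$ is a homomorphism onto a central subgroup of $Z^2$, and $\mathrm{H}^2_\ell(G)=Z^2/\delta^1(A^1)$. $\mathrm{Int}_k(G)$ is the group of automorphisms of $G$ of the form $g\mapsto aga^{-1}$ with $a$ in the normalizer of $G$ in $k[G]^\times$; $\mathrm{Inn}(G)\subset\mathrm{Int}_k(G)$ is the group of inner automorphisms. For a finite abelian group $A$ let $\widehat A=\mathrm{Hom}(A,k^\times)$. $\mathcal{B}(G)$ is the set of pairs $(A,b)$ where $A$ is an abelian normal subgroup of $G$ and $b:\widehat A\times\widehat A\to k^\times$ is a bilinear form that is alternating ($b(\chi,\chi)=1$ for all $\chi$), non-degenerate, and invariant under the action of $G$ on $\widehat A$ induced by conjugation. It always contains the element $1=(\{1\},1)$ (the trivial form on the trivial subgroup). *)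

(* Defs.v *)
From HB Require Import structures.
From mathcomp Require Import boolp classical_sets.
From mathcomp Require Import all_boot all_order all_algebra all_fingroup.
From mathcomp Require Import falgebra.

Set Implicit Arguments.
Unset Strict Implicit.
Unset Printing Implicit Defensive.

Import GRing.Theory.
Local Open Scope ring_scope.

Section UnitGroup.

Variable R : unitRingType.

Record ugroup := Ugroup {ugval :> R; ugvalP : ugval \is a GRing.unit}.

HB.instance Definition _ := [isSub for ugval].
HB.instance Definition _ := [Choice of ugroup by <:].

Implicit Types u v w : ugroup.

Fact ug_mul_subproof u v : ugval u * ugval v \is a GRing.unit.
Proof. by rewrite unitrMl ?ugvalP. Qed.

Fact ug_inv_subproof u : (ugval u)^-1 \is a GRing.unit.
Proof. by rewrite unitrV ugvalP. Qed.

Definition ug_one := Ugroup (unitr1 R).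
Definition ug_mul u v := Ugroup (ug_mul_subproof u v).
Definition ug_inv u := Ugroup (ug_inv_subproof u).

Fact ug_mulA : associative ug_mul.
Proof. by move=> u v w; apply: val_inj; rewrite /= mulrA. Qed.
Fact ug_mul1 : left_id ug_one ug_mul.
Proof. by move=> u; apply: val_inj; rewrite /= mul1r. Qed.
Fact ug_1mul : right_id ug_one ug_mul.
Proof. by move=> u; apply: val_inj; rewrite /= mulr1. Qed.
Fact ug_mulV : left_inverse ug_one ug_inv ug_mul.
Proof. by move=> u; apply: val_inj; rewrite /= mulVr ?ugvalP. Qed.
Fact ug_Vmul : right_inverse ug_one ug_inv ug_mul.
Proof. by move=> u; apply: val_inj; rewrite /= mulrV ?ugvalP. Qed.

HB.instance Definition _ :=
  isGroup.Build ugroup ug_mulA ug_mul1 ug_1mul ug_mulV ug_Vmul.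

Lemma ug_val1 : ugval 1%g = 1. Proof. by []. Qed.
Lemma ug_valM u v : ugval (u * v)%g = ugval u * ugval v. Proof. by []. Qed.
Lemma ug_valV u : ugval (u^-1)%g = (ugval u)^-1. Proof. by []. Qed.

End UnitGroup.

Record normal_subgroup (W : groupType) := NormalSubgroup {
  nsub_pred :> {pred W};
  nsub_closed : group_closed nsub_pred;
  nsub_normal : forall x y : W,
    y \in nsub_pred -> (x * y * x^-1)%g \in nsub_pred }.

Section Quotient.

Variables (W : groupType) (N : normal_subgroup W).
Implicit Types x y z : W.

Let N1 : 1%g \in (N : {pred W}) := (nsub_closed N).1.
Let NF : {in N &, forall x y, (x * y^-1)%g \in N} := (nsub_closed N).2.
Let NV x : x \in N -> (x^-1)%g \in N.
Proof. by move=> Nx; rewrite -[x^-1%g]mul1g NF. Qed.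
Let NM : {in N &, forall x y, (x * y)%g \in N}.
Proof. by move=> x y Nx Ny; rewrite -[y]invgK NF // NV. Qed.

Definition coset_rel : rel W := fun x y => (x^-1 * y)%g \in N.

Fact coset_rel_refl : reflexive coset_rel.
Proof. by move=> x; rewrite /coset_rel mulVg. Qed.
Fact coset_rel_sym : symmetric coset_rel.
Proof.
by apply: symmetric_from_pre => x y /NV; rewrite /coset_rel invgM invgK.
Qed.
Fact coset_rel_trans : transitive coset_rel.
Proof.
by move=> y x z Nxy /(NM Nxy); rewrite /coset_rel mulgA mulgK.
Qed.

Canonical coset_equiv :=
  EquivRel coset_rel coset_rel_refl coset_rel_sym coset_rel_trans.

Definition quotient_group := {eq_quot coset_equiv}%qT.
HB.instance Definition _ := EqQuotient.on quotient_group.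
HB.instance Definition _ := Choice.on quotient_group.

Local Notation repr := generic_quotient.repr.

Definition qpi (x : W) : quotient_group := \pi_(quotient_group)%qT x.

Definition qg_one : quotient_group := qpi 1%g.
Definition qg_mul (a b : quotient_group) : quotient_group :=
  qpi (repr a * repr b)%g.
Definition qg_inv (a : quotient_group) : quotient_group := qpi (repr a)^-1%g.

Lemma qpi_eq x y : (qpi x = qpi y) <-> (x^-1 * y)%g \in N.
Proof. by split => [/eqmodP | Nxy]; last apply/eqmodP. Qed.

Lemma qpi_surj a : exists x, qpi x = a.
Proof. by exists (repr a); rewrite /qpi reprK. Qed.

Lemma qpi_repr x : (x^-1 * repr (qpi x))%g \in N.
Proof. by apply/qpi_eq; rewrite /qpi reprK. Qed.

Lemma qpiM x y : qg_mul (qpi x) (qpi y) = qpi (x * y)%g.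
Proof.
apply/esym/qpi_eq; set x' := repr _; set y' := repr _.
have ->: ((x * y)^-1 * (x' * y') =
  (y^-1 * (x^-1 * x') * y^-1^-1) * (y^-1 * y'))%g.
  by rewrite invgM invgK !mulgA mulgK.
by rewrite NM ?qpi_repr // nsub_normal // qpi_repr.
Qed.

Lemma qpiV x : qg_inv (qpi x) = qpi x^-1%g.
Proof.
apply/esym/qpi_eq; set x' := repr _.
have ->: (x^-1^-1 * x'^-1 = x * (x^-1 * x')^-1 * x^-1)%g.
  by rewrite invgM !invgK -!mulgA mulgV mulg1.
by rewrite nsub_normal // NV // qpi_repr.
Qed.

Fact qg_mulA : associative qg_mul.
Proof.
move=> a b c; have [x <-] := qpi_surj a; have [y <-] := qpi_surj b.
by have [z <-] := qpi_surj c; rewrite !qpiM mulgA.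
Qed.
Fact qg_mul1 : left_id qg_one qg_mul.
Proof. by move=> a; have [x <-] := qpi_surj a; rewrite qpiM mul1g. Qed.
Fact qg_1mul : right_id qg_one qg_mul.
Proof. by move=> a; have [x <-] := qpi_surj a; rewrite qpiM mulg1. Qed.
Fact qg_mulV : left_inverse qg_one qg_inv qg_mul.
Proof. by move=> a; have [x <-] := qpi_surj a; rewrite qpiV qpiM mulVg. Qed.
Fact qg_Vmul : right_inverse qg_one qg_inv qg_mul.
Proof. by move=> a; have [x <-] := qpi_surj a; rewrite qpiV qpiM mulgV. Qed.

HB.instance Definition _ :=
  isGroup.Build quotient_group qg_mulA qg_mul1 qg_1mul qg_mulV qg_Vmul.

HB.instance Definition _ :=
  isGroupMorphism.Build W quotient_group qpi
    (fun x y => esym (etrans (congr1 _ (qpiV y)) (qpiM x y^-1%g))).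

Lemma qpi_eq1 x : (qpi x = 1%g) <-> x \in N.
Proof.
by split=> [/esym/qpi_eq | Nx]; [|apply/esym/qpi_eq]; rewrite invg1 mul1g.
Qed.

End Quotient.

Definition group_iso (G H : groupType) : Prop :=
  exists f : {multiplicative G -> H}, bijective f.

Section GroupAlgebraDef.

Variables (k : fieldType) (gT : finGroupType).

(* A separate name, since [{ffun gT -> k^o}] itself carries the pointwise
   product. *)
Definition galg : Type := {ffun gT -> k^o}.
HB.instance Definition _ := Vector.copy galg {ffun gT -> k^o}.

Definition galg_coef (x : galg) (g : gT) : k := (x : {ffun gT -> k^o}) g.

Definition ge (g : gT) : galg := [ffun h => ((h == g)%:R : k)].

Definition galg_mul (x y : galg) : galg :=
  [ffun g => \sum_h galg_coef x h * galg_coef y (h^-1 * g)%g].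

End GroupAlgebraDef.

Arguments ge {k gT} g.
Notation "x @_ g" := (galg_coef x g)
  (at level 3, left associativity, g at level 2, format "x @_ g") : ring_scope.

Section GroupAlgebraRing.

Variables (k : fieldType) (gT : finGroupType).
Local Notation A := (galg k gT).
Implicit Types (x y z : A) (g h : gT) (c : k).

Lemma galgP x y : (forall g, x@_g = y@_g) <-> x = y.
Proof. by split=> [exy | -> //]; apply/ffunP => g; apply: exy. Qed.

Lemma coefD x y g : (x + y)@_g = x@_g + y@_g.
Proof. by rewrite /galg_coef ffunE. Qed.
Lemma coefZ c x g : (c *: x)@_g = c * x@_g.
Proof. by rewrite /galg_coef ffunE. Qed.
Lemma coef0 g : (0 : A)@_g = 0.
Proof. by rewrite /galg_coef ffunE. Qed.
Lemma coef_ge g h : (ge g : A)@_h = (h == g)%:R.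
Proof. by rewrite /galg_coef ffunE. Qed.
Lemma coef_sum I (r : seq I) (P : pred I) (F : I -> A) g :
  (\sum_(i <- r | P i) F i)@_g = \sum_(i <- r | P i) (F i)@_g.
Proof. exact: (big_morph _ (fun x y => coefD x y g) (coef0 g)). Qed.
Lemma coefM x y g : (galg_mul x y)@_g = \sum_h x@_h * y@_((h^-1 * g)%g).
Proof. by rewrite {1}/galg_coef ffunE. Qed.

Fact galg_mulA : associative (@galg_mul k gT).
Proof.
move=> x y z; apply/galgP => g; rewrite !coefM.
under [RHS]eq_bigr => h _ do rewrite coefM big_distrl /=.
rewrite exchange_big /=; apply: eq_bigr => l _.
rewrite coefM big_distrr /= (reindex_inj (mulgI l^-1%g)) /=.
by apply: eq_bigr => m _; rewrite invgM invgK !mulgA mulgK mulrA.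
Qed.

Fact galg_mul1 : left_id (ge 1%g) (@galg_mul k gT).
Proof.
move=> x; apply/galgP => g; rewrite coefM (bigD1 1%g) //= big1 => [|h nh].
  by rewrite coef_ge eqxx mul1r invg1 mul1g addr0.
by rewrite coef_ge (negPf nh) mul0r.
Qed.

Fact galg_1mul : right_id (ge 1%g) (@galg_mul k gT).
Proof.
move=> x; apply/galgP => g; rewrite coefM (bigD1 g) //= big1 => [|h nh].
  by rewrite coef_ge mulVg eqxx mulr1 addr0.
rewrite coef_ge -[(_ * _)%g == 1%g](inj_eq (mulgI h)) mulVKg mulg1.
by rewrite eq_sym (negPf nh) mulr0.
Qed.

Fact galg_mulDl : left_distributive (@galg_mul k gT) +%R.
Proof.
move=> x y z; apply/galgP => g; rewrite coefD !coefM -big_split /=.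
by apply: eq_bigr => h _; rewrite coefD mulrDl.
Qed.

Fact galg_mulDr : right_distributive (@galg_mul k gT) +%R.
Proof.
move=> x y z; apply/galgP => g; rewrite coefD !coefM -big_split /=.
by apply: eq_bigr => h _; rewrite coefD mulrDr.
Qed.

Fact galg_1neq0 : (ge 1%g : A) != 0.
Proof.
apply/eqP => /(congr1 (fun x : A => x@_(1%g))); rewrite coef_ge coef0 eqxx.
by move/eqP; rewrite oner_eq0.
Qed.

HB.instance Definition _ := GRing.Zmodule_isNzRing.Build A
  galg_mulA galg_mul1 galg_1mul galg_mulDl galg_mulDr galg_1neq0.

Fact galg_scalerAl c x y : c *: (x * y) = (c *: x) * y.
Proof.
apply/galgP => g; rewrite coefZ !coefM big_distrr /=.
by apply: eq_bigr => h _; rewrite coefZ mulrA.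
Qed.

Fact galg_scalerAr c x y : c *: (x * y) = x * (c *: y).
Proof.
apply/galgP => g; rewrite coefZ !coefM big_distrr /=.
by apply: eq_bigr => h _; rewrite coefZ mulrCA.
Qed.

HB.instance Definition _ := GRing.Lmodule_isLalgebra.Build k A galg_scalerAl.
HB.instance Definition _ := GRing.Lalgebra_isAlgebra.Build k A galg_scalerAr.
HB.instance Definition _ := Algebra_isFalgebra.Build k A.

Lemma ge1 : ge 1%g = 1 :> A. Proof. by []. Qed.

Lemma geM g h : ge (g * h)%g = ge g * ge h :> A.
Proof.
apply/galgP => l; rewrite coefM (bigD1 g) //= big1 => [|m nm].
  rewrite !coef_ge eqxx mul1r addr0.
  by rewrite -[(_ * l)%g == h](inj_eq (mulgI g)) mulVKg.
by rewrite coef_ge (negPf nm) mul0r.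
Qed.

Lemma ge_inj : injective (@ge k gT).
Proof.
move=> g h /(congr1 (fun x : A => x@_g)); rewrite !coef_ge eqxx.
by case: eqP => // _ /eqP; rewrite oner_eq0.
Qed.

Lemma ge_unit g : (ge g : A) \is a GRing.unit.
Proof.
by apply/unitrP; exists (ge g^-1%g); rewrite -!geM mulgV mulVg ge1.
Qed.

Lemma galgE x : x = \sum_g x@_g *: ge g.
Proof.
apply/galgP => g; rewrite coef_sum (bigD1 g) //= big1 => [|h nh].
  by rewrite coefZ coef_ge eqxx mulr1 addr0.
by rewrite coefZ coef_ge eq_sym (negPf nh) mulr0.
Qed.

End GroupAlgebraRing.

Section Glin.

Variables (k : fieldType) (gT : finGroupType).
Local Notation A := (galg k gT).

(* The linear extension of a map defined on the basis [gT] of [k[gT]]. *)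
Definition glin (V : lmodType k) (phi : gT -> V) (x : A) : V :=
  \sum_g x@_g *: phi g.

Fact glin_linear (V : lmodType k) (phi : gT -> V) : linear (glin phi).
Proof.
move=> c x y; rewrite /glin scaler_sumr -big_split /=.
by apply: eq_bigr => g _; rewrite coefD coefZ scalerDl scalerA.
Qed.
HB.instance Definition _ (V : lmodType k) (phi : gT -> V) :=
  GRing.isLinear.Build k A V _ (@glin V phi) (@glin_linear V phi).

Lemma glin_ge (V : lmodType k) (phi : gT -> V) g : glin phi (ge g) = phi g.
Proof.
rewrite /glin (bigD1 g) //= big1 => [|h nh].
  by rewrite coef_ge eqxx scale1r addr0.
by rewrite coef_ge (negPf nh) scale0r.
Qed.

Lemma glin_eq (V : lmodType k) (phi : gT -> V) (f : {linear A -> V}) :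
  (forall g, f (ge g) = phi g) -> f =1 glin phi.
Proof.
move=> ef x; rewrite {1}(galgE x) linear_sum; apply: eq_bigr => g _.
by rewrite linearZ_LR ef.
Qed.

Lemma glinM (B : algType k) (phi : gT -> B) :
  {morph phi : g h / (g * h)%g >-> g * h} -> {morph glin phi : x y / x * y}.
Proof.
move=> phiM x y; rewrite {1}(galgE x) {1}(galgE y).
rewrite big_distrl /= linear_sum {2}/glin big_distrl; apply: eq_bigr => g _ /=.
rewrite !big_distrr /= linear_sum; apply: eq_bigr => h _ /=.
rewrite -scalerAl -scalerAr !linearZ_LR /= -geM glin_ge phiM.
by rewrite -scalerAl -scalerAr.
Qed.

End Glin.

Section Tensor.

Variable k : fieldType.

(* The tensor product of [k[gT]] and [k[hT]] is realized as [k[gT * hT]], the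
   tensor of [g] and [h] being the pair [(g, h)]; its universal property is
   [tens_universal]. *)
Definition tens (gT hT : finGroupType) (x : galg k gT) (y : galg k hT) :
    galg k (gT * hT)%type :=
  [ffun p => x@_(p.1) * y@_(p.2)].

Definition tens_map (gT hT gT' hT' : finGroupType)
    (f : galg k gT -> galg k gT') (f' : galg k hT -> galg k hT') :
    galg k (gT * hT)%type -> galg k (gT' * hT')%type :=
  glin (fun p => tens (f (ge p.1)) (f' (ge p.2))).

Definition tens_assoc (gT hT lT : finGroupType) :
    galg k (gT * (hT * lT))%type -> galg k (gT * hT * lT)%type :=
  glin (fun p => ge (p.1, p.2.1, p.2.2)).

Definition Delta (gT : finGroupType) : galg k gT -> galg k (gT * gT)%type :=
  glin (fun g => ge (g, g)).

Section Theory.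

Variables gT hT : finGroupType.
Implicit Types (x : galg k gT) (y : galg k hT).

Lemma coef_tens x y p : (tens x y)@_p = x@_(p.1) * y@_(p.2).
Proof. by rewrite {1}/galg_coef ffunE. Qed.

Lemma tens_ge (g : gT) (h : hT) : tens (ge g) (ge h) = ge (g, h).
Proof.
by apply/galgP => p; rewrite coef_tens !coef_ge -natrM mulnb -pair_eqE.
Qed.

Lemma tens11 : tens (1 : galg k gT) (1 : galg k hT) = 1.
Proof. exact: tens_ge. Qed.

Lemma tensM x x' y y' : tens (x * x') (y * y') = tens x y * tens x' y'.
Proof.
apply/galgP => -[g h]; rewrite coef_tens !coefM big_distrlr pair_bigA /=.
by apply: eq_bigr => -[g' h'] _; rewrite !coef_tens /= mulrACA.
Qed.

Fact tens_linearl y : linear (fun x => tens x y).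
Proof.
move=> c x x'; apply/galgP => p.
by rewrite coefD coefZ !coef_tens coefD coefZ mulrDl mulrA.
Qed.

Fact tens_linearr x : linear (tens x : galg k hT -> _).
Proof.
move=> c y y'; apply/galgP => p.
by rewrite coefD coefZ !coef_tens coefD coefZ mulrDr mulrCA.
Qed.

Lemma glin_tens (V : lmodType k) (beta : galg k gT -> galg k hT -> V) x y :
  (forall y, linear (beta ^~ y)) -> (forall x, linear (beta x)) ->
  glin (fun p : gT * hT => beta (ge p.1) (ge p.2)) (tens x y) = beta x y.
Proof.
move=> bl br.
pose L y : {linear galg k gT -> V} :=
  HB.pack (beta ^~ y) (GRing.isLinear.Build k _ _ _ (beta ^~ y) (bl y)).
pose R x : {linear galg k hT -> V} :=
  HB.pack (beta x) (GRing.isLinear.Build k _ _ _ (beta x) (br x)).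
have E1 : beta x y = \sum_g x@_g *: beta (ge g) y.
  rewrite -[LHS]/(L y x) {1}(galgE x) linear_sum.
  by apply: eq_bigr => g _; rewrite linearZ_LR.
have E2 g : beta (ge g) y = \sum_h y@_h *: beta (ge g) (ge h).
  rewrite -[LHS]/(R (ge g) y) {1}(galgE y) linear_sum.
  by apply: eq_bigr => h _; rewrite linearZ_LR.
rewrite E1; under [RHS]eq_bigr => g _ do rewrite E2 scaler_sumr.
rewrite pair_bigA /= /glin; apply: eq_bigr => -[g h] _ /=.
by rewrite coef_tens scalerA.
Qed.

Lemma tens_universal (V : lmodType k) (beta : galg k gT -> galg k hT -> V) :
  (forall y, linear (beta ^~ y)) -> (forall x, linear (beta x)) ->
  exists! f : galg k (gT * hT)%type -> V,
    linear f /\ forall x y, f (tens x y) = beta x y.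
Proof.
move=> bl br; exists (glin (fun p : gT * hT => beta (ge p.1) (ge p.2))).
split=> [|f [fl fE]].
  by split=> [|x y]; [exact: glin_linear | exact: glin_tens].
pose f' : {linear _ -> V} := HB.pack f (GRing.isLinear.Build k _ _ _ f fl).
apply/funext => x; apply/esym/(glin_eq (f := f')) => -[g h] /=.
by rewrite -tens_ge fE.
Qed.

End Theory.

Lemma Delta_ge (gT : finGroupType) (g : gT) : Delta (ge g) = ge (g, g).
Proof. exact: glin_ge. Qed.

Lemma DeltaM (gT : finGroupType) : {morph @Delta gT : x y / x * y}.
Proof. by apply: glinM => g h; rewrite -geM. Qed.

Lemma Delta1 (gT : finGroupType) : @Delta gT 1 = 1.
Proof. by rewrite /Delta -ge1 glin_ge. Qed.

Lemma tens_assocM (gT hT lT : finGroupType) :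
  {morph @tens_assoc gT hT lT : x y / x * y}.
Proof. by apply: glinM => g h; rewrite -geM. Qed.

Lemma tens_assoc1 (gT hT lT : finGroupType) : @tens_assoc gT hT lT 1 = 1.
Proof. by rewrite /tens_assoc -ge1 glin_ge. Qed.

Lemma tens_assocE (gT hT lT : finGroupType) x y z :
  @tens_assoc gT hT lT (tens x (tens y z)) = tens (tens x y) z.
Proof.
apply/galgP => -[[g h] l].
rewrite /tens_assoc /glin coef_sum (bigD1 (g, (h, l))) //= big1 => [|p np].
  by rewrite coefZ coef_ge eqxx mulr1 addr0 !coef_tens /= mulrA.
rewrite coefZ coef_ge; case: eqP => [[e1 e2 e3]|_]; last by rewrite mulr0.
by case/eqP: np; rewrite e1 e2 e3; case: (p) => ? [].
Qed.

Lemma tens_mapM (gT hT gT' hT' : finGroupType)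
    (f : galg k gT -> galg k gT') (f' : galg k hT -> galg k hT') :
  {morph f : x y / x * y} -> {morph f' : x y / x * y} ->
  {morph tens_map f f' : x y / x * y}.
Proof.
by move=> fM fM'; apply: glinM => p q; rewrite !geM fM fM' tensM.
Qed.

Lemma tens_map1 (gT hT gT' hT' : finGroupType)
    (f : galg k gT -> galg k gT') (f' : galg k hT -> galg k hT') :
  f 1 = 1 -> f' 1 = 1 -> tens_map f f' 1 = 1.
Proof. by move=> f1 f'1; rewrite /tens_map -ge1 glin_ge f1 f'1 tens11. Qed.

Lemma tens_mapE (gT hT gT' hT' : finGroupType)
    (f : galg k gT -> galg k gT') (f' : galg k hT -> galg k hT') x y :
  linear f -> linear f' -> tens_map f f' (tens x y) = tens (f x) (f' y).
Proof.
move=> lf lf'; apply: (glin_tens (beta := fun x y => tens (f x) (f' y))) => z.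
  by move=> c u v; rewrite lf; exact: tens_linearl.
by move=> c u v; rewrite lf'; exact: tens_linearr.
Qed.

Lemma Delta_linear (gT : finGroupType) : linear (@Delta gT).
Proof. exact: glin_linear. Qed.

Lemma Delta_coassoc (gT : finGroupType) (x : galg k gT) :
  tens_map (@Delta gT) id (Delta x) =
  tens_assoc (tens_map id (@Delta gT) (Delta x)).
Proof.
transitivity (glin (fun g => ge (g, g, g)) x).
  apply: (glin_eq (f := glin _ \o glin _)) => g.
  by rewrite /= !glin_ge /= Delta_ge tens_ge.
symmetry; apply: (glin_eq (f := glin _ \o (glin _ \o glin _))) => g.
by rewrite /= !glin_ge /= Delta_ge tens_ge glin_ge.
Qed.

Lemma tens_unit (gT hT : finGroupType) (x : galg k gT) (y : galg k hT) :
  x \is a GRing.unit -> y \is a GRing.unit -> tens x y \is a GRing.unit.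
Proof.
move=> Ux Uy; apply/unitrP; exists (tens x^-1 y^-1).
by rewrite -!tensM !mulVr // !mulrV // tens11.
Qed.

Lemma tens_central (gT hT : finGroupType) (x : galg k gT) (y : galg k hT) :
  (forall b, x * b = b * x) -> (forall b, y * b = b * y) ->
  forall b, tens x y * b = b * tens x y.
Proof.
move=> xC yC b; rewrite (galgE b) mulr_sumr mulr_suml.
apply: eq_bigr => -[g h] _.
by rewrite -scalerAr -scalerAl -tens_ge -!tensM xC yC.
Qed.

Lemma Delta_unit (gT : finGroupType) (x : galg k gT) :
  x \is a GRing.unit -> Delta x \is a GRing.unit.
Proof.
move=> Ux; apply/unitrP; exists (Delta x^-1).
by rewrite -!DeltaM mulVr // mulrV // Delta1.
Qed.

Lemma tens1_comm (gT : finGroupType) (F x : galg k (gT * gT)%type) :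
  (forall a : galg k gT, Delta a * F = F * Delta a) ->
  tens F (1 : galg k gT) * tens_map (@Delta gT) id x =
  tens_map (@Delta gT) id x * tens F 1.
Proof.
move=> FC; rewrite /tens_map /glin mulr_sumr mulr_suml; apply: eq_bigr => p _.
by rewrite -scalerAr -scalerAl -!tensM FC mulr1 mul1r.
Qed.

Lemma tens1_commr (gT : finGroupType) (F x : galg k (gT * gT)%type) :
  (forall a : galg k gT, Delta a * F = F * Delta a) ->
  tens (1 : galg k gT) F * tens_map id (@Delta gT) x =
  tens_map id (@Delta gT) x * tens 1 F.
Proof.
move=> FC; rewrite /tens_map /glin mulr_sumr mulr_suml; apply: eq_bigr => p _.
by rewrite -scalerAr -scalerAl -!tensM FC mulr1 mul1r.
Qed.

End Tensor.

Section InvariantTwists.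

Variables (k : fieldType) (gT : finGroupType).
Local Notation A := (galg k gT).
Local Notation AA := (galg k (gT * gT)%type).
Local Notation Delta_id := (tens_map (@Delta k gT) (@id A)).
Local Notation id_Delta := (tens_map (@id A) (@Delta k gT)).

(* The triple tensor power is [k[(gT * gT) * gT]]; [tens_assoc] carries the
   right-hand side, computed in [k[gT * (gT * gT)]], into it. *)
Definition is_twist (F : ugroup AA) : Prop :=
  tens (ugval F) (1 : A) * Delta_id (ugval F) =
  tens_assoc (tens (1 : A) (ugval F) * id_Delta (ugval F)).

Definition is_invariant (F : ugroup AA) : Prop :=
  forall a : A, Delta a * ugval F = ugval F * Delta a.

Definition inv_twist : {pred ugroup AA} :=
  fun F => `[< is_twist F /\ is_invariant F >].

Lemma inv_twistP F : reflect (is_twist F /\ is_invariant F) (F \in inv_twist).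
Proof. exact: asboolP. Qed.

Fact inv_twist_closed : group_closed inv_twist.
Proof.
have tl (F F' : AA) : tens (F * F') (1 : A) = tens F 1 * tens F' 1.
  by rewrite -tensM mulr1.
have tr (F F' : AA) : tens (1 : A) (F * F') = tens 1 F * tens 1 F'.
  by rewrite -tensM mulr1.
have m1 := tens_mapM (@DeltaM k gT)
  (fun x y => erefl : id (x * y) = x * y :> A).
have m2 := tens_mapM
  (fun x y => erefl : id (x * y) = x * y :> A) (@DeltaM k gT).
have m11 : Delta_id 1 = 1.
  by apply: tens_map1 => //; exact: Delta1.
have m21 : id_Delta 1 = 1.
  by apply: tens_map1 => //; exact: Delta1.
split=> [|F F' /inv_twistP[tF iF] /inv_twistP[tF' iF']].
  apply/inv_twistP; split=> [|a] /=; last by rewrite mulr1 mul1r.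
  by rewrite /is_twist /= m11 m21 !tens11 !mulr1 tens_assoc1.
have iV (a : A) : Delta a * (ugval F')^-1 = (ugval F')^-1 * Delta a.
  apply: (mulrI (ugvalP F')); rewrite mulVKr ?ugvalP // mulrA -iF' mulrK //.
  exact: ugvalP.
have tV : is_twist F'^-1%g.
  rewrite /is_twist /= tens1_comm // tens1_commr //.
  set l := (LHS); pose l' := tens (ugval F') 1 * Delta_id (ugval F').
  have ll' : l * l' = 1.
    rewrite /l /l' mulrA -[X in X * _]mulrA -tl mulVr ?ugvalP // tens11 mulr1.
    by rewrite -m1 mulVr ?ugvalP.
  have l'l : l' * l = 1.
    rewrite /l /l' mulrA -[X in X * _]mulrA -m1 mulrV ?ugvalP // m11 mulr1.
    by rewrite -tl mulrV ?ugvalP // tens11.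
  have Ul' : l' \is a GRing.unit by apply/unitrP; exists l.
  apply: (mulIr Ul'); rewrite ll' /l' tF' -tens_assocM mulrA.
  rewrite -[X in tens_assoc (X * _)]mulrA -tr mulVr ?ugvalP // tens11 mulr1.
  by rewrite -m2 mulVr ?ugvalP // m21 tens_assoc1.
apply/inv_twistP; split=> [|a] /=; last first.
  by rewrite mulrA iF -mulrA iV mulrA.
rewrite /is_twist /= tl m1 tr m2.
rewrite mulrA -[X in X * _]mulrA (tens1_comm _ iV) mulrA tF.
rewrite -mulrA; move: (tV); rewrite /is_twist /= => ->.
rewrite -tens_assocM; congr tens_assoc.
by rewrite !mulrA; congr (_ * _); rewrite -!mulrA (tens1_commr _ iV).
Qed.

Record Z2 := MkZ2 {Z2val :> ugroup AA; Z2valP : Z2val \in inv_twist}.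
HB.instance Definition _ := [isSub for Z2val].
HB.instance Definition _ := [Choice of Z2 by <:].
HB.instance Definition _ :=
  SubChoice_isSubGroup.Build _ _ Z2 inv_twist_closed.

Definition central_unit : {pred ugroup A} :=
  fun a => `[< forall b : A, ugval a * b = b * ugval a >].

Lemma central_unitP a :
  reflect (forall b : A, ugval a * b = b * ugval a) (a \in central_unit).
Proof. exact: asboolP. Qed.

Fact central_unit_closed : group_closed central_unit.
Proof.
split=> [|a a' /central_unitP aC /central_unitP aC'].
  by apply/central_unitP => b; rewrite mulr1 mul1r.
apply/central_unitP => b /=; rewrite -mulrA.
have -> : (ugval a')^-1 * b = b * (ugval a')^-1.
  apply: (mulrI (ugvalP a')); rewrite mulVKr ?ugvalP // mulrA aC' mulrK //.
  exact: ugvalP.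
by rewrite mulrA aC mulrA.
Qed.

Record A1 := MkA1 {A1val :> ugroup A; A1valP : A1val \in central_unit}.
HB.instance Definition _ := [isSub for A1val].
HB.instance Definition _ := [Choice of A1 by <:].
HB.instance Definition _ :=
  SubChoice_isSubGroup.Build _ _ A1 central_unit_closed.

Lemma cunitC (a : A1) (b : A) : ugval a * b = b * ugval a.
Proof. exact: (central_unitP _ (A1valP a)). Qed.

Definition delta1_val (a : A1) : AA :=
  tens (ugval a) (ugval a) * Delta (ugval a)^-1.

Fact delta1_unit a : delta1_val a \is a GRing.unit.
Proof.
rewrite unitrMl ?Delta_unit ?unitrV ?ugvalP //.
by rewrite tens_unit ?ugvalP.
Qed.

Fact delta1_subproof a : Ugroup (delta1_unit a) \in inv_twist.
Proof.
set u := ugval a; have Uu : u \is a GRing.unit := ugvalP a.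
have m1 := tens_mapM (@DeltaM k gT)
  (fun x y => erefl : id (x * y) = x * y :> A).
have m2 := tens_mapM
  (fun x y => erefl : id (x * y) = x * y :> A) (@DeltaM k gT).
have e1 : tens (tens u u * Delta u^-1) (1 : A) * tens (Delta u) u =
    tens (tens u u) u.
  by rewrite -tensM mul1r -mulrA -DeltaM mulVr // Delta1 mulr1.
have e2 : tens (1 : A) (tens u u * Delta u^-1) * tens u (Delta u) =
    tens u (tens u u).
  by rewrite -tensM mul1r -mulrA -DeltaM mulVr // Delta1 mulr1.
apply/inv_twistP; split=> [|b] /=; rewrite /is_twist /= /delta1_val -/u.
  rewrite m1 m2 !tens_mapE //; try exact: Delta_linear.
  by rewrite mulrA e1 mulrA e2 Delta_coassoc tens_assocM tens_assocE.
rewrite mulrA -(tens_central (cunitC a) (cunitC a)) -!mulrA; congr (_ * _).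
rewrite -!DeltaM; congr Delta.
apply: (mulrI Uu); rewrite mulVKr // mulrA cunitC mulrK //.
Qed.

Definition delta1 (a : A1) : Z2 := MkZ2 (delta1_subproof a).

Lemma delta1M : {morph delta1 : a b / (a * b)%g}.
Proof.
move=> a b; apply/val_inj/val_inj => /=; rewrite /delta1_val.
have -> : ugval (a * b)%g = ugval a * ugval b by [].
have Ub := ugvalP b.
have c1 : (ugval b)^-1 * (ugval a)^-1 = (ugval a)^-1 * (ugval b)^-1.
  by rewrite -!invrM ?ugvalP // cunitC.
have c2 := tens_central (cunitC b) (cunitC b) (Delta (ugval a)^-1).
rewrite invrM ?ugvalP // c1 DeltaM tensM !mulrA -(mulrA (tens _ _)) c2.
by rewrite !mulrA.
Qed.

Lemma delta1_central a (z : Z2) : (delta1 a * z = z * delta1 a)%g.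
Proof.
apply/val_inj/val_inj => /=; rewrite /delta1_val.
have [_ iz] := inv_twistP _ (Z2valP z).
have c := tens_central (cunitC a) (cunitC a) (ugval z).
transitivity (tens (ugval a) (ugval a) * Delta (ugval a)^-1 * ugval z) => //.
by rewrite -mulrA iz mulrA c -mulrA.
Qed.

Definition delta1_im : {pred Z2} :=
  fun z => `[< exists a, delta1 a = z >].

Fact delta1_im_closed : group_closed delta1_im.
Proof.
have d1 : delta1 1%g = 1%g.
  by apply: (mulgI (delta1 1%g)); rewrite -delta1M !mulg1.
split=> [|z z' /asboolP[a <-] /asboolP[a' <-]]; apply/asboolP.
  by exists 1%g.
exists (a * a'^-1)%g; apply: (mulIg (delta1 a')).
by rewrite -delta1M !mulgVK.
Qed.

Fact delta1_im_normal x y :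
  y \in delta1_im -> (x * y * x^-1)%g \in delta1_im.
Proof.
move=> /asboolP[a <-]; rewrite -delta1_central mulgK.
by apply/asboolP; exists a.
Qed.

Definition B2 := NormalSubgroup delta1_im_closed delta1_im_normal.

Definition H2l : groupType := quotient_group B2.

End InvariantTwists.

Section IntInn.

Variables (k : fieldType) (gT : finGroupType).
Local Notation A := (galg k gT).
Implicit Types (p q : {perm gT}).

Definition normalizes (a : ugroup A) : Prop :=
  ((fun x : A => ugval a * x * (ugval a)^-1) @` range ge = range ge)%classic.

Definition Int_spec p : Prop :=
  exists2 a : ugroup A, normalizes a &
    forall g, ge (p g) = ugval a * ge g * (ugval a)^-1.

Definition Int : {set {perm gT}} :=
  [set p in Aut [set: gT] | `[< Int_spec p >]].

Lemma normalizesM a b : normalizes a -> normalizes b -> normalizes (a * b)%g.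
Proof.
move=> na nb; rewrite /normalizes -[in RHS]na -[in RHS]nb [RHS]image_comp.
by apply: eq_imagel => x _ /=; rewrite invrM ?ugvalP // !mulrA.
Qed.

Lemma IntP p : reflect (p \in Aut [set: gT] /\ Int_spec p) (p \in Int).
Proof.
have -> : (p \in Int) = (p \in Aut [set: gT]) && `[< Int_spec p >].
  exact: (in_set _ p).
by apply: (iffP andP) => -[Ap /asboolP]. Qed.

Fact Int_group_set : group_set Int.
Proof.
apply/group_setP; split=> [|p q].
  apply/IntP; split; [exact: group1 | exists 1%g => [|g] /=].
    rewrite /normalizes /= -[RHS]image_id; apply: eq_imagel => x _.
    by rewrite invr1 mulr1 mul1r.
  by rewrite perm1 invr1 mulr1 mul1r.
move=> /IntP[Ap [a na pa]] /IntP[Aq [b nb qb]].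
apply/IntP; split; [exact: groupM | exists (b * a)%g => [|g] /=].
  exact: normalizesM.
by rewrite permM qb pa invrM ?ugvalP // !mulrA.
Qed.
Canonical Int_group := Group Int_group_set.

Definition Inn : {group {perm gT}} := (conj_aut [set: gT] @* [set: gT])%G.

Lemma InnP p : reflect (exists a, forall g, p g = (a * g * a^-1)%g) (p \in Inn).
Proof.
apply: (iffP morphimP) => [[x _ _ ->]|[a pE]].
  exists x^-1%g => g; rewrite conj_autE ?inE // conjgE mulgA invgK //.
exists a^-1%g; [by rewrite (subsetP (normG _)) ?inE | by rewrite inE |].
by apply/permP => g; rewrite /= conj_autE ?inE // pE conjgE invgK mulgA.
Qed.

Lemma Inn_sub_Int : Inn \subset Int.
Proof.
apply/subsetP => p Ip; have [a pE] := InnP _ Ip; apply/IntP.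
split; first exact: subsetP (Aut_conj_aut _ _) _ Ip.
have geV (g : gT) : (ge g : A)^-1 = ge g^-1%g.
  by apply: (mulrI (ge_unit k g)); rewrite divrr ?ge_unit // -geM mulgV.
exists (Ugroup (ge_unit k a)) => [|g] /=; last first.
  by rewrite geV -!geM pE.
rewrite /normalizes /= geV; apply/seteqP; split=> x /=.
  by move=> [_ [g _ <-] <-]; exists (a * g * a^-1)%g => //; rewrite !geM.
move=> [g _ <-]; exists (ge (a^-1 * g * a)%g); first by exists (a^-1 * g * a)%g.
by rewrite -!geM !mulgA mulgV mul1g mulgK.
Qed.

Lemma Inn_normal_Int : (Inn <| Int)%g.
Proof.
apply/andP; split; first exact: Inn_sub_Int.
apply/subsetP => p /IntP[Ap _].
have pM := morphicP (Aut_morphic Ap).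
rewrite inE; apply/subsetP => _ /imsetP[q /InnP[a qE] ->].
have {}pM : {morph p : x y / (x * y)%g} by move=> x y; rewrite pM ?inE.
have pV x : p x^-1%g = ((p x)^-1)%g.
  apply: (mulgI (p x)); rewrite -pM !mulgV.
  by apply: (mulgI (p 1%g)); rewrite -pM !mulg1.
apply/InnP; exists (p a) => g.
by rewrite conjgE !permM qE !pM pV permKV.
Qed.

End IntInn.

Section CalB.

Variables (k : fieldType) (gT : finGroupType).

Section Dual.

Variable A : {group gT}.

Definition is_char : {pred {ffun [subg A] -> ugroup k}} :=
  fun chi => [forall x, forall y, chi (x * y)%g == (chi x * chi y)%g].

Fact ugroupC (u v : ugroup k) : (u * v = v * u)%g.
Proof. by apply: val_inj; rewrite /= mulrC. Qed.

Fact is_charP (chi : {ffun [subg A] -> ugroup k}) :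
  reflect {morph chi : x y / (x * y)%g} (chi \in is_char).
Proof.
apply: (iffP forallP) => [H x y | H x]; first exact/eqP/(forallP (H x)).
by apply/forallP => y; apply/eqP.
Qed.

Fact is_char_closed : group_closed is_char.
Proof.
split=> [|chi psi /is_charP chiM /is_charP psiM]; apply/is_charP => x y.
  by rewrite !ffunE mulg1.
rewrite !ffunE chiM psiM invgM -!mulgA; congr (_ * _)%g.
by rewrite mulgA ugroupC.
Qed.

Record dual := Dual {
  dval :> {ffun [subg A] -> ugroup k};
  dvalP : dval \in is_char }.
HB.instance Definition _ := [isSub for dval].
HB.instance Definition _ := [Choice of dual by <:].
HB.instance Definition _ := SubChoice_isSubGroup.Build _ _ dual is_char_closed.

End Dual.

Record abnormal := AbNormal {
  abn_group :> {group gT};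
  abnP : abelian abn_group && (abn_group <| [set: gT])%g }.

Section Action.

Variable A : abnormal.

Definition conj_subg (g : gT) (a : [subg A]) : [subg A] := subg A (val a ^ g)%g.

Lemma val_conj_subg g a : val (conj_subg g a) = (val a ^ g)%g.
Proof.
have /andP[_ /normal_norm nA] := abnP A.
by rewrite subgK // memJ_norm ?subgP // (subsetP nA) ?inE.
Qed.

Fact dual_act_subproof (g : gT) (chi : dual A) :
  [ffun a => dval chi (conj_subg g a)] \in @is_char A.
Proof.
apply/is_charP => x y; rewrite !ffunE -(is_charP _ (dvalP chi)).
by congr (dval chi _); apply: val_inj; rewrite /= !val_conj_subg /= conjMg.
Qed.

(* [g] sends [chi] to [a |-> chi (g^-1 * a * g)]. *)
Definition dual_act (g : gT) (chi : dual A) : dual A :=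
  Dual (dual_act_subproof g chi).

Variable b : dual A -> dual A -> ugroup k.

Definition bilinear_form : Prop :=
  (forall psi, {morph b ^~ psi : x y / (x * y)%g}) /\
  (forall chi, {morph b chi : x y / (x * y)%g}).

Definition alternating_form : Prop := forall chi, b chi chi = 1%g.

Definition nondegenerate_form : Prop :=
  (forall chi, (forall psi, b chi psi = 1%g) -> chi = 1%g) /\
  (forall psi, (forall chi, b chi psi = 1%g) -> psi = 1%g).

Definition invariant_form : Prop :=
  forall g chi psi, b (dual_act g chi) (dual_act g psi) = b chi psi.

End Action.

Definition pair_type : Type := {A : abnormal & dual A -> dual A -> ugroup k}.

Definition calB : set pair_type :=
  [set Ab | let: existT A b := Ab in
     [/\ bilinear_form b, alternating_form b, nondegenerate_form b
       & invariant_form b]]%classic.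

Fact trivial_abnormal_subproof :
  abelian [1 gT]%G && ([1 gT]%G <| [set: gT])%g.
Proof. by rewrite abelian1 normal1. Qed.

Definition calB_one : pair_type :=
  existT _ (AbNormal trivial_abnormal_subproof) (fun _ _ => 1%g).

Lemma calB_one_in : calB calB_one.
Proof.
have triv (chi : dual [1 gT]%G) : chi = 1%g.
  apply/val_inj/ffunP => x; rewrite ffunE.
  have -> : x = 1%g by apply: val_inj; apply/set1gP/subgP.
  have chiM x1 y1 : dval chi (x1 * y1)%g = (dval chi x1 * dval chi y1)%g.
    exact: (is_charP _ (dvalP chi)).
  by apply: (mulgI (dval chi 1%g)); rewrite -chiM !mulg1.
by split=> //; split=> ? x y; rewrite mulg1.
Qed.

End CalB.

Arguments calB : clear implicits.

(* Main.v *)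
(**
The isomorphism sends the class of the twist [F_a = (a (x) a) Delta(a^-1)], for
[a] normalizing [G], to the class of the automorphism [g |-> a^-1 g a]; both
kernels consist of the products of a central unit and an element of [G]. What
has to be shown is that every invariant twist [F] is of this form.

Put [R = F_21^-1 F]. Invariance and the twist equation give
[(id (x) Delta) R = R_13 R_12], [(Delta (x) id) R = R_13 R_23] and
[R_21 = R^-1]. Hence the components [l_h] of [R = sum_h l_h (x) h] are orthogonal
idempotents, the [h] with [l_h <> 0] form an abelian normal subgroup [A], and
[R] lies in [k[A] (x) k[A]] and defines an invariant non-degenerate
skew-symmetric form on the dual of [A]. It is alternating because
[kappa(g (x) h) = g^-1 h] satisfies [kappa(F) = kappa(F_21) kappa(R)], while
applying [x (x) y (x) z |-> x y^-1 z] to the twist equation yields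
[kappa(F) = kappa(F_21)], which is a unit. So if [B(G)] is trivial, [A] is trivial,
[R = 1] and [F] is symmetric.

For symmetric [F] the operators [(delta_g (x) id) (F Delta(x))] on [k[G]] commute.
A joint eigenvector, suitably scaled, satisfies [F Delta(a) = a (x) a]; such an
[a] is invertible, since applying [delta_g] to the first leg of
[Delta(a) = F^-1 (a (x) a)] writes a nonzero multiple of some [g] as [y a].
*)

Require Import Defs.
From HB Require Import structures.
From mathcomp Require Import boolp classical_sets.
From mathcomp Require Import all_boot all_order all_algebra all_fingroup.

Set Implicit Arguments.
Unset Strict Implicit.
Unset Printing Implicit Defensive.

Import Defs GRing.Theory VectorInternalTheory.
Local Open Scope ring_scope.

(** * Common eigenvectors *)

Section CommonEigenvector.

Variables (k : closedFieldType) (n : nat).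

(** By Cayley-Hamilton, the linear factors of the characteristic polynomial, applied one after
    another to a nonzero vector of [U], end at zero. The last nonzero vector reached is an
    eigenvector, and it stays in [U] by stability. *)
Lemma stable_eigenvector (T U : 'M[k]_n) :
  U != 0 -> (U *m T <= U)%MS ->
  exists2 v : 'rV_n, v != 0 & (v <= U)%MS /\ exists c, v *m T = c *: v.
Proof.
case: n T U => [|n'] T U nzU UT.
  by case/eqP: nzU; apply/matrixP => -[].
have [rs Ers] := closed_field_poly_normal (char_poly T).
have := Cayley_Hamilton T; rewrite Ers (monicP (char_poly_monic T)) scale1r.
move=> annT; have {annT} : nz_row U *m horner_mx T (\prod_(z <- rs) ('X - z%:P)) = 0.
  by rewrite annT mulmx0.
have := nz_row_sub U; have : nz_row U != 0 by rewrite nz_row_eq0.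
elim: rs {Ers} (nz_row U) => [|z rs IHrs] w nzw wU.
  by rewrite big_nil rmorph1 mulmx1 => w0; rewrite w0 eqxx in nzw.
rewrite big_cons rmorphM rmorphB /= horner_mx_X horner_mx_C -mulmxE mulmxA.
have [w0 _|nzw' rw0] := eqVneq (w *m (T - z%:M)) 0.
  exists w => //; split=> //; exists z; apply/eqP.
  by rewrite -subr_eq0 -mul_mx_scalar -mulmxBr w0.
apply: IHrs rw0 => //; rewrite mulmxBr mul_mx_scalar addmx_sub //.
  exact: submx_trans (submxMr _ wU) UT.
by rewrite -scaleNr scalemx_sub.
Qed.

(** Induction on the rank of [U]: if some [T i] is not scalar on [U], one of its eigenspaces meets
    [U] in a nonzero proper subspace, which is stable because the family commutes. *)
Lemma commuting_eigenvector (I : Type) (T : I -> 'M[k]_n) (U : 'M[k]_n) :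
  (forall i j, T i *m T j = T j *m T i) -> U != 0 ->
  (forall i, (U *m T i <= U)%MS) ->
  exists2 v : 'rV_n, v != 0 & (v <= U)%MS /\ forall i, exists c, v *m T i = c *: v.
Proof.
move=> TC; have [m] := ubnP (\rank U); elim: m U => // m IHm U ltUm nzU UT.
have [scal|] := pselect (forall i, exists c, U *m T i = c *: U).
  exists (nz_row U); rewrite ?nz_row_eq0 //; split=> [|i]; first exact: nz_row_sub.
  have [c Uc] := scal i; exists c; have /submxP[D ->] := nz_row_sub U.
  by rewrite -mulmxA Uc scalemxAr.
move=> /existsNP[i] /forallNP nscal.
have [v nzv [vU [c vc]]] := stable_eigenvector nzU (UT i).
pose K := kermx (T i - c%:M).
have capK m' (w : 'M_(m', n)) : (w <= U :&: K)%MS = (w <= U)%MS && (w *m T i == c *: w).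
  by rewrite sub_capmx (sameP sub_kermxP eqP) mulmxBr mul_mx_scalar subr_eq0.
have vUK : (v <= U :&: K)%MS by rewrite capK vU vc eqxx.
have [||j|w nzw [wUK wT]] := IHm (U :&: K)%MS.
- rewrite -ltnS; apply: leq_trans ltUm; rewrite ltnS rank_ltmx // /ltmx capmxSl /=.
  apply/negP; rewrite capK => /andP[_ /eqP]; exact: nscal.
- apply: contraNneq nzv => UK0; move: vUK; rewrite UK0 submx0. exact.
- rewrite capK (submx_trans (submxMr _ (capmxSl _ _)) (UT j)) /=.
  have : (U :&: K <= U :&: K)%MS by [].
  rewrite capK => /andP[_ /eqP UKc].
  by rewrite -mulmxA TC mulmxA UKc scalemxAl.
- by exists w => //; split=> //; exact: submx_trans wUK (capmxSl _ _).
Qed.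

End CommonEigenvector.

(** The stable subspace is the image of [e]. It is used with [e] the identity for symmetric twists,
    and with [e] multiplication by [a - 1] to find a character nontrivial at [a]. *)
Lemma commuting_eigenvector_image (k : closedFieldType) (V : vectType k)
    (I : Type) (T : I -> {linear V -> V}) (e : {linear V -> V}) (x0 : V) :
  (forall i j x, T i (T j x) = T j (T i x)) ->
  (forall i x, T i (e x) = e (T i x)) -> e x0 != 0 ->
  exists2 x, e x != 0 & forall i, exists c, T i (e x) = c *: e x.
Proof.
move=> TC Te nz0; pose mx (f : {linear V -> V}) := lin1_mx (v2r \o f \o r2v).
have mxE (f : {linear V -> V}) u : u *m mx f = v2r (f (r2v u)).
  by rewrite mul_rV_lin1.
have mxC (f g : {linear V -> V}) :
    (forall x, f (g x) = g (f x)) -> mx f *m mx g = mx g *m mx f.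
  move=> fg; apply/row_matrixP => i; rewrite !row_mul [row i (mx f)]rowE.
  by rewrite [row i (mx g)]rowE !mxE !v2rK fg.
have [|||v nzv [/submxP[w vE] Tv]] :=
    @commuting_eigenvector k _ I (fun i => mx (T i)) (mx e).
- by move=> i j; apply: mxC => x; apply: TC.
- apply: contraNneq nz0 => e0; rewrite -(inj_eq (@v2r_inj k V)) linear0.
  by rewrite -[x0]v2rK -mxE e0 mulmx0.
- by move=> i; rewrite (mxC e) ?submxMl.
have vE' : r2v v = e (r2v w) by rewrite vE mxE v2rK.
exists (r2v w) => [|i]; rewrite -vE'.
  by rewrite -(inj_eq (@v2r_inj k V)) r2vK linear0.
have [c vT] := Tv i; exists c; apply: (@v2r_inj k V).
by rewrite -mxE vT linearZ /= r2vK.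
Qed.

(** * The R-matrix of an invariant twist *)

Section GMap.

Variables (k : fieldType).

(** Placing legs in slots, permuting slots, doubling a leg and applying the counit to a leg all have
    this form, so tensor identities reduce to identities between maps of groups. *)
Definition gmap (G H : finGroupType) (phi : G -> H) : galg k G -> galg k H :=
  glin (fun g => ge (phi g)).

Lemma gmap_ge (G H : finGroupType) (phi : G -> H) g : gmap phi (ge g) = ge (phi g).
Proof. exact: glin_ge. Qed.

HB.instance Definition _ (G H : finGroupType) (phi : G -> H) :=
  GRing.Linear.on (gmap phi).

Lemma galg_ext (G : finGroupType) (V : lmodType k) (f f' : galg k G -> V) :
  linear f -> linear f' -> (forall g, f (ge g) = f' (ge g)) -> f =1 f'.
Proof.
move=> lf lf' ff' x.
pose L : {linear galg k G -> V} := HB.pack f (GRing.isLinear.Build k _ _ _ f lf).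
pose L' : {linear galg k G -> V} :=
  HB.pack f' (GRing.isLinear.Build k _ _ _ f' lf').
rewrite -[f x]/(L x) -[f' x]/(L' x) (galgE x) !linear_sum.
by apply: eq_bigr => g _; rewrite !linearZ_LR /= ff'.
Qed.

Lemma gmap_linear (G H : finGroupType) (phi : G -> H) : linear (gmap phi).
Proof. exact: glin_linear. Qed.

Lemma gmapM (G H : finGroupType) (phi : G -> H) :
  {morph phi : x y / (x * y)%g} -> {morph gmap phi : x y / x * y}.
Proof. by move=> phiM; apply: glinM => x y; rewrite phiM geM. Qed.

Lemma gmap1 (G H : finGroupType) (phi : G -> H) :
  {morph phi : x y / (x * y)%g} -> gmap phi 1 = 1.
Proof.
move=> phiM; rewrite -ge1 gmap_ge -ge1; congr ge.
by apply: (mulgI (phi 1%g)); rewrite -phiM !mulg1.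
Qed.

Lemma gmap_unit (G H : finGroupType) (phi : G -> H) x :
  {morph phi : x y / (x * y)%g} -> x \is a GRing.unit ->
  gmap phi x \is a GRing.unit.
Proof.
move=> phiM Ux; apply/unitrP; exists (gmap phi x^-1).
by rewrite -!gmapM // mulVr // mulrV // gmap1.
Qed.

Lemma gmap_comp (G H L : finGroupType) (phi : G -> H) (psi : H -> L) x :
  gmap psi (gmap phi x) = gmap (fun g => psi (phi g)) x.
Proof.
apply: (galg_ext (f := fun x => gmap psi (gmap phi x))) => [c u v|c u v|g].
- by rewrite !linearP.
- by rewrite linearP.
- by rewrite !gmap_ge.
Qed.

Lemma gmapM_comp (G G' H L : finGroupType) (phi : G -> H) (psi : G' -> H)
    (sigma : H -> L) x y : {morph sigma : p q / (p * q)%g} ->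
  gmap sigma (gmap phi x * gmap psi y) =
  gmap (fun p => sigma (phi p)) x * gmap (fun p => sigma (psi p)) y.
Proof. by move=> sM; rewrite gmapM // !gmap_comp. Qed.

(** A general form of [F_12 (Delta (x) id)(y) = (Delta (x) id)(y) F_12]: each [psi q] is a diagonal
    part, passed by invariance of [F], times a factor [c q] commuting with the legs of [F]. *)
Lemma gmap_Delta_comm (G H L : finGroupType) (F : galg k (G * G)%type)
    (phi : G * G -> H) (psi : L -> H) (s : L -> G) (c : L -> H) y :
  (forall a, Delta a * F = F * Delta a) ->
  {morph phi : p q / (p * q)%g} -> (forall q, psi q = (phi (s q, s q) * c q)%g) ->
  (forall p q, (phi p * c q = c q * phi p)%g) ->
  gmap phi F * gmap psi y = gmap psi y * gmap phi F.
Proof.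
move=> FC phiM psiE cC.
have phic q : gmap phi F * ge (c q) = ge (c q) * gmap phi F.
  rewrite /gmap /glin mulr_suml mulr_sumr; apply: eq_bigr => p _.
  by rewrite -scalerAl -scalerAr -!geM cC.
rewrite [gmap psi y]/gmap /glin mulr_sumr mulr_suml; apply: eq_bigr => q _.
rewrite -scalerAr -scalerAl psiE geM; congr (_ *: _).
have -> : ge (phi (s q, s q)) = gmap phi (Delta (ge (s q))).
  by rewrite Delta_ge gmap_ge.
by rewrite mulrA -gmapM // -FC gmapM // -!mulrA phic.
Qed.

End GMap.

Definition leg_swap (gT : finGroupType) (p : gT * gT) := (p.2, p.1).
Local Notation swap := (gmap (@leg_swap _)).

Section Twists.

Variables (k : fieldType) (gT : finGroupType).
Local Notation A := (galg k gT).
Local Notation AA := (galg k (gT * gT)%type).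

Let mor3 (a b c : gT * gT -> gT) :
  {morph a : p q / (p * q)%g} -> {morph b : p q / (p * q)%g} ->
  {morph c : p q / (p * q)%g} -> {morph (fun p => (a p, b p, c p)) : p q / (p * q)%g}.
Proof. by move=> aM bM cM p q; rewrite aM bM cM. Qed.

Lemma swapK : involutive (swap : AA -> AA).
Proof.
move=> x; rewrite gmap_comp; apply: (galg_ext (f' := id)) => //.
- exact: gmap_linear.
- by move=> [g h]; rewrite gmap_ge.
Qed.

Lemma swap_invariant (F : AA) : (forall a : A, Delta a * F = F * Delta a) ->
  forall a : A, Delta a * swap F = swap F * Delta a.
Proof.
move=> FC a; have -> : Delta a = swap (Delta a).
  apply: (galg_ext (f' := fun x => swap (Delta x))) => [|c x y|g].
  - exact: Delta_linear.
  - by rewrite Delta_linear linearP.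
  - by rewrite Delta_ge gmap_ge.
by rewrite -!gmapM // FC.
Qed.

Lemma is_twistE (F : ugroup AA) : is_twist F <->
  gmap (fun p => (p.1, p.2, 1%g)) (ugval F) * gmap (fun p => (p.1, p.1, p.2)) (ugval F) =
  gmap (fun p => (1%g, p.1, p.2)) (ugval F) * gmap (fun p => (p.1, p.2, p.2)) (ugval F).
Proof.
rewrite /is_twist tens_assocM.
set x := ugval F.
have -> : tens x (1 : A) = gmap (fun p => (p.1, p.2, 1%g)) x.
  apply: (galg_ext (f := fun x : AA => tens x (1 : A)) (f' := gmap _)) => [||[g h]].
  - exact: tens_linearl.
  - exact: gmap_linear.
  - by rewrite -ge1 tens_ge gmap_ge.
have -> : tens_map (@Delta k gT) id x = gmap (fun p => (p.1, p.1, p.2)) x.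
  apply: galg_ext => [||[g h]]; try exact: gmap_linear.
  - exact: glin_linear.
  - by rewrite /tens_map glin_ge gmap_ge Delta_ge tens_ge.
have -> : tens_assoc (tens (1 : A) x) = gmap (fun p => (1%g, p.1, p.2)) x.
  apply: (galg_ext (f := fun x : AA => tens_assoc (tens (1 : A) x))
    (f' := gmap _)) => [c u v||[g h]].
  - by rewrite tens_linearr; exact: glin_linear.
  - exact: gmap_linear.
  - by rewrite -ge1 tens_ge gmap_ge /tens_assoc glin_ge.
have -> // : tens_assoc (tens_map id (@Delta k gT) x) = gmap (fun p => (p.1, p.2, p.2)) x.
apply: (galg_ext (f := fun x : AA => tens_assoc (tens_map id (@Delta k gT) x))
  (f' := gmap _)) => [c u v||[g h]].
- by rewrite /tens_map /tens_assoc !linearP.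
- exact: gmap_linear.
- by rewrite /tens_map glin_ge gmap_ge Delta_ge tens_ge /tens_assoc glin_ge.
Qed.

Variable F : AA.
Hypothesis FU : F \is a GRing.unit.
Definition Rmat := (swap F)^-1 * F.
Local Notation R := Rmat.

Lemma swap_unit x : x \is a GRing.unit -> (swap x : AA) \is a GRing.unit.
Proof. by move=> Ux; apply: gmap_unit. Qed.

Lemma RmatE : swap F * R = F.
Proof. exact: mulVKr (swap_unit FU) F. Qed.

Lemma Rmat_unit : R \is a GRing.unit.
Proof. by rewrite /R unitrMl ?unitrV ?swap_unit. Qed.

Lemma Rmat_swap : swap R * R = 1.
Proof.
apply: (mulrI FU); rewrite mulr1 mulrA -{1}[F]swapK -gmapM // RmatE.
exact: RmatE.
Qed.

Let Rmat_leg (phi : gT * gT -> gT * gT * gT) : {morph phi : p q / (p * q)%g} ->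
  gmap (fun p => phi (leg_swap p)) F * gmap phi R = gmap phi F.
Proof. by move=> phiM; rewrite -[in RHS]RmatE gmapM // gmap_comp. Qed.

Hypothesis FC : forall a : A, Delta a * F = F * Delta a.

Lemma Rmat_invariant (a : A) : Delta a * R = R * Delta a.
Proof.
apply: (mulrI (swap_unit FU)).
by rewrite mulrA -(swap_invariant FC) -[in LHS]mulrA RmatE FC mulrA RmatE.
Qed.

(* [mij] puts the two legs in the slots [i] and [j] of the triple tensor power,
   [dij] doubles the first leg into these slots and [eij] the second one. *)
Let m12 (p : gT * gT) := (p.1, p.2, 1%g : gT).
Let m13 (p : gT * gT) := (p.1, 1%g : gT, p.2).
Let m31 (p : gT * gT) := (p.2, 1%g : gT, p.1).
Let m23 (p : gT * gT) := (1%g : gT, p.1, p.2).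
Let m32 (p : gT * gT) := (1%g : gT, p.2, p.1).
Let m21 (p : gT * gT) := (p.2, p.1, 1%g : gT).
Let d12 (p : gT * gT) := (p.1, p.1, p.2).
Let d13 (p : gT * gT) := (p.1, p.2, p.1).
Let d23 (p : gT * gT) := (p.2, p.1, p.1).
Let e12 (p : gT * gT) := (p.2, p.2, p.1).
Let e13 (p : gT * gT) := (p.2, p.1, p.2).
Let e23 (p : gT * gT) := (p.1, p.2, p.2).

Let one_morph : {morph (fun p : gT * gT => 1%g : gT) : p q / (p * q)%g}.
Proof. by move=> p q; rewrite mulg1. Qed.
Let d12M : {morph d12 : p q / (p * q)%g}. Proof. exact: mor3. Qed.
Let d23M : {morph d23 : p q / (p * q)%g}. Proof. exact: mor3. Qed.
Let e12M : {morph e12 : p q / (p * q)%g}. Proof. exact: mor3. Qed.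
Let e23M : {morph e23 : p q / (p * q)%g}. Proof. exact: mor3. Qed.
Let m12M : {morph m12 : p q / (p * q)%g}. Proof. exact: mor3. Qed.
Let m13M : {morph m13 : p q / (p * q)%g}. Proof. exact: mor3. Qed.
Let m31M : {morph m31 : p q / (p * q)%g}. Proof. exact: mor3. Qed.
Let m23M : {morph m23 : p q / (p * q)%g}. Proof. exact: mor3. Qed.
Let m32M : {morph m32 : p q / (p * q)%g}. Proof. exact: mor3. Qed.
Let m21M : {morph m21 : p q / (p * q)%g}. Proof. exact: mor3. Qed.

(** This and the next seven facts express invariance: [F] placed in two slots commutes with any
    element whose doubled leg fills these slots. Here [s] selects the doubled leg and [c] puts the
    other one in the remaining slot. *)
Let c12_12 : gmap m12 F * gmap d12 F = gmap d12 F * gmap m12 F.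
Proof.
apply: (gmap_Delta_comm (s := fst) (c := fun q => (1%g, 1%g, q.2)) _ FC m12M)
  => [[g h]|[g h] [g' h']];
  clear; congr (_, _, _); rewrite /= ?mulg1 ?mul1g //.
Qed.
Let c21_12 : gmap m21 F * gmap d12 F = gmap d12 F * gmap m21 F.
Proof.
apply: (gmap_Delta_comm (s := fst) (c := fun q => (1%g, 1%g, q.2)) _ FC m21M)
  => [[g h]|[g h] [g' h']];
  clear; congr (_, _, _); rewrite /= ?mulg1 ?mul1g //.
Qed.
Let c13_13 : gmap m13 F * gmap e13 F = gmap e13 F * gmap m13 F.
Proof.
apply: (gmap_Delta_comm (s := snd) (c := fun q => (1%g, q.1, 1%g)) _ FC m13M)
  => [[g h]|[g h] [g' h']];
  clear; congr (_, _, _); rewrite /= ?mulg1 ?mul1g //.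
Qed.
Let c31_13 : gmap m31 F * gmap e13 F = gmap e13 F * gmap m31 F.
Proof.
apply: (gmap_Delta_comm (s := snd) (c := fun q => (1%g, q.1, 1%g)) _ FC m31M)
  => [[g h]|[g h] [g' h']];
  clear; congr (_, _, _); rewrite /= ?mulg1 ?mul1g //.
Qed.
Let c23_23 : gmap m23 F * gmap e23 F = gmap e23 F * gmap m23 F.
Proof.
apply: (gmap_Delta_comm (s := snd) (c := fun q => (q.1, 1%g, 1%g)) _ FC m23M)
  => [[g h]|[g h] [g' h']];
  clear; congr (_, _, _); rewrite /= ?mulg1 ?mul1g //.
Qed.
Let c32_23 : gmap m32 F * gmap e23 F = gmap e23 F * gmap m32 F.
Proof.
apply: (gmap_Delta_comm (s := snd) (c := fun q => (q.1, 1%g, 1%g)) _ FC m32M)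
  => [[g h]|[g h] [g' h']];
  clear; congr (_, _, _); rewrite /= ?mulg1 ?mul1g //.
Qed.
Let c13_d13 : gmap m13 F * gmap d13 F = gmap d13 F * gmap m13 F.
Proof.
apply: (gmap_Delta_comm (s := fst) (c := fun q => (1%g, q.2, 1%g)) _ FC m13M)
  => [[g h]|[g h] [g' h']];
  clear; congr (_, _, _); rewrite /= ?mulg1 ?mul1g //.
Qed.
Let c31_d13 : gmap m31 F * gmap d13 F = gmap d13 F * gmap m31 F.
Proof.
apply: (gmap_Delta_comm (s := fst) (c := fun q => (1%g, q.2, 1%g)) _ FC m31M)
  => [[g h]|[g h] [g' h']];
  clear; congr (_, _, _); rewrite /= ?mulg1 ?mul1g //.
Qed.

Hypothesis tw :
  gmap (fun p => (p.1, p.2, 1%g)) F * gmap (fun p => (p.1, p.1, p.2)) F =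
  gmap (fun p => (1%g, p.1, p.2)) F * gmap (fun p => (p.1, p.2, p.2)) F.

(** The twist equation with its slots permuted; the digits of the name list the old slots in their
    new order, here and in the three facts below. *)
Let t312 : gmap m23 F * gmap d23 F = gmap m31 F * gmap e13 F.
Proof.
have sM : {morph (fun t : gT * gT * gT => (t.2, t.1.1, t.1.2)) : p q / (p * q)%g} by [].
exact: etrans (esym (gmapM_comp _ _ _ _ sM))
  (etrans (congr1 _ tw) (gmapM_comp _ _ _ _ sM)).
Qed.

Let t213 : gmap m21 F * gmap d12 F = gmap m13 F * gmap e13 F.
Proof.
have sM : {morph (fun t : gT * gT * gT => (t.1.2, t.1.1, t.2)) : p q / (p * q)%g} by [].
exact: etrans (esym (gmapM_comp _ _ _ _ sM))
  (etrans (congr1 _ tw) (gmapM_comp _ _ _ _ sM)).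
Qed.

Let t231 : gmap m31 F * gmap d13 F = gmap m12 F * gmap e12 F.
Proof.
have sM : {morph (fun t : gT * gT * gT => (t.1.2, t.2, t.1.1)) : p q / (p * q)%g} by [].
exact: etrans (esym (gmapM_comp _ _ _ _ sM))
  (etrans (congr1 _ tw) (gmapM_comp _ _ _ _ sM)).
Qed.

Let t132 : gmap m13 F * gmap d13 F = gmap m32 F * gmap e23 F.
Proof.
have sM : {morph (fun t : gT * gT * gT => (t.1.1, t.2, t.1.2)) : p q / (p * q)%g} by [].
exact: etrans (esym (gmapM_comp _ _ _ _ sM))
  (etrans (congr1 _ tw) (gmapM_comp _ _ _ _ sM)).
Qed.

(** Multiply on the left by the units [F_23] and [(id (x) Delta)(F_21)]. Permuted twist equations
    and invariance bring the factors of [F] next to those of [R], where [F_21 R_12 = F_12] and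
    [F_31 R_13 = F_13] apply. *)
Lemma Rmat_id_Delta :
  gmap (fun p => (p.1, p.2, p.2)) R =
  gmap (fun p => (p.1, 1%g, p.2)) R * gmap (fun p => (p.1, p.2, 1%g)) R.
Proof.
have R12 : gmap m21 F * gmap m12 R = gmap m12 F := Rmat_leg m12M.
have R13 : gmap m31 F * gmap m13 R = gmap m13 F := Rmat_leg m13M.
have R123 : gmap d23 F * gmap e23 R = gmap e23 F := Rmat_leg e23M.
have U23 := gmap_unit m23M FU.
have U231 := gmap_unit d23M FU.
rewrite -[LHS]/(gmap e23 R) -[RHS]/(gmap m13 R * gmap m12 R).
apply: (mulrI U231); apply: (mulrI U23).
rewrite R123 -[LHS]tw -[LHS]/(gmap m12 F * gmap d12 F) c12_12 -R12 mulrA -c21_12 t213 c13_13.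
by rewrite -R13 !mulrA t312 c31_13.
Qed.

(** The mirror image of the previous argument, multiplying by [F_12] and [(Delta (x) id)(F_21)]. *)
Lemma Rmat_Delta_id :
  gmap (fun p => (p.1, p.1, p.2)) R =
  gmap (fun p => (p.1, 1%g, p.2)) R * gmap (fun p => (1%g, p.1, p.2)) R.
Proof.
have R23 : gmap m32 F * gmap m23 R = gmap m23 F := Rmat_leg m23M.
have R13 : gmap m31 F * gmap m13 R = gmap m13 F := Rmat_leg m13M.
have R123 : gmap e12 F * gmap d12 R = gmap d12 F := Rmat_leg d12M.
have U12 := gmap_unit m12M FU.
have U312 := gmap_unit e12M FU.
rewrite -[LHS]/(gmap d12 R) -[RHS]/(gmap m13 R * gmap m23 R).
apply: (mulrI U312); apply: (mulrI U12).
rewrite R123 [LHS]tw -[LHS]/(gmap m23 F * gmap e23 F) c23_23 -R23 mulrA -c32_23 -t132.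
by rewrite c13_d13 -R13 !mulrA -t231 c31_d13.
Qed.

End Twists.

(** * R-matrices in a group algebra *)

Section Slices.

Variables (k : fieldType).

(** The device for applying a linear map to a tensor identity: products become double sums over
    coefficients, which are then compared term by term. *)
Lemma glin_gmapM (G G' H : finGroupType) (V : lmodType k) (f : H -> V)
    (a : G -> H) (b : G' -> H) x y :
  glin f (gmap a x * gmap b y) =
  \sum_p \sum_q (x@_p * y@_q) *: f (a p * b q)%g.
Proof.
rewrite /gmap {2}/glin mulr_suml linear_sum; apply: eq_bigr => p _ /=.
rewrite {2}/glin mulr_sumr linear_sum; apply: eq_bigr => q _ /=.
by rewrite -scalerAr -scalerAl scalerA linearZ_LR /= -geM glin_ge mulrC.
Qed.

Lemma glin_gmap (G H : finGroupType) (V : lmodType k) (f : H -> V) (a : G -> H) x :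
  glin f (gmap a x) = glin (fun p => f (a p)) x.
Proof.
rewrite /gmap {2}/glin linear_sum; apply: eq_bigr => p _ /=.
by rewrite linearZ_LR /= glin_ge.
Qed.

Lemma mul_glin (G G' : finGroupType) (B : algType k) (f : G -> B) (f' : G' -> B) x y :
  glin f x * glin f' y = \sum_p \sum_q (x@_p * y@_q) *: (f p * f' q).
Proof.
rewrite /glin mulr_suml; apply: eq_bigr => p _; rewrite mulr_sumr.
by apply: eq_bigr => q _; rewrite -scalerAr -scalerAl scalerA mulrC.
Qed.

Lemma glin_mull (G : finGroupType) (x y : galg k G) :
  glin (fun g => x * ge g) y = x * y.
Proof.
by rewrite [in RHS](galgE y) mulr_sumr; apply: eq_bigr => g _; rewrite scalerAr.
Qed.

Lemma gmap_id (G : finGroupType) (x : galg k G) : gmap id x = x.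
Proof. by rewrite [RHS]galgE. Qed.

Lemma coef_gmap (G H : finGroupType) (f : G -> H) (x : galg k G) g :
  injective f -> (gmap f x)@_(f g) = x@_g.
Proof.
move=> fI; rewrite /gmap /glin coef_sum (bigD1 g) //= big1 => [|h nh].
  by rewrite coefZ coef_ge eqxx mulr1 addr0.
by rewrite coefZ coef_ge (inj_eq fI) eq_sym (negPf nh) mulr0.
Qed.

Lemma coef_gemul (G : finGroupType) (x : galg k G) g h :
  (ge g * x)@_((g * h)%g) = x@_h.
Proof.
rewrite -{1}[x]gmap_id /gmap /glin mulr_sumr coef_sum (bigD1 h) //= big1 => [|l nl].
  by rewrite -scalerAr -geM coefZ coef_ge eqxx mulr1 addr0.
by rewrite -scalerAr -geM coefZ coef_ge (inj_eq (mulgI g)) eq_sym (negPf nl) mulr0.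
Qed.

Lemma coef_mulge (G : finGroupType) (x : galg k G) g h :
  (x * ge g)@_((h * g)%g) = x@_h.
Proof.
rewrite -{1}[x]gmap_id /gmap /glin mulr_suml coef_sum (bigD1 h) //= big1 => [|l nl].
  by rewrite -scalerAl -geM coefZ coef_ge eqxx mulr1 addr0.
by rewrite -scalerAl -geM coefZ coef_ge (inj_eq (mulIg g)) eq_sym (negPf nl) mulr0.
Qed.

Variable gT : finGroupType.
Local Notation A := (galg k gT).
Local Notation AA := (galg k (gT * gT)%type).

(** Compare the coefficients of [Delta(x) F] and [F Delta(x)] at [(g x, h x)]. *)
Lemma invariant_coef (F : AA) x g h :
  (forall a : A, Delta a * F = F * Delta a) -> F@_((g ^ x, h ^ x)%g) = F@_((g, h)).
Proof.
move=> FC; have := congr1 (fun X : AA => X@_((g * x, h * x)%g)) (FC (ge x)).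
rewrite Delta_ge => E; rewrite -[RHS](coef_mulge F (x, x) (g, h)) -[RHS]E.
rewrite -(coef_gemul F (x, x)); congr (_@_( _ )).
by apply/eqP; rewrite xpair_eqE -!conjgC !eqxx.
Qed.

(* [lslice x h] and [rslice x g] are the components in [x = \sum_h lslice x h (x) h =
   \sum_g g (x) rslice x g]. *)
Definition lslice (x : AA) (h : gT) : A := glin (fun p => (p.2 == h)%:R *: ge p.1) x.
Definition rslice (x : AA) (g : gT) : A := glin (fun p => (p.1 == g)%:R *: ge p.2) x.

Lemma coef_lslice x h g : (lslice x h)@_g = x@_((g, h)).
Proof.
rewrite /lslice /glin coef_sum (bigD1 (g, h)) //= big1 => [|[g' h'] ne].
  by rewrite !coefZ coef_ge !eqxx !mulr1 addr0.
rewrite !coefZ coef_ge /=; case: eqP => [eh|]; last by rewrite mul0r mulr0.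
case: eqP => [eg|]; last by rewrite !mulr0.
by case/eqP: ne; rewrite eh eg.
Qed.

Lemma coef_rslice x g h : (rslice x g)@_h = x@_((g, h)).
Proof.
rewrite /rslice /glin coef_sum (bigD1 (g, h)) //= big1 => [|[g' h'] ne].
  by rewrite !coefZ coef_ge !eqxx !mulr1 addr0.
rewrite !coefZ coef_ge /=; case: eqP => [eh|]; last by rewrite mul0r mulr0.
case: eqP => [eg|]; last by rewrite !mulr0.
by case/eqP: ne; rewrite eh eg.
Qed.

Lemma sum_lslice x : \sum_h lslice x h = gmap fst x.
Proof.
rewrite /lslice /glin exchange_big; apply: eq_bigr => p _ /=.
rewrite (bigD1 p.2) //= eqxx scale1r big1 ?addr0 // => h nh.
by rewrite eq_sym (negPf nh) scale0r scaler0.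
Qed.

Lemma sum_rslice x : \sum_g rslice x g = gmap snd x.
Proof.
rewrite /rslice /glin exchange_big; apply: eq_bigr => p _ /=.
rewrite (bigD1 p.1) //= eqxx scale1r big1 ?addr0 // => h nh.
by rewrite eq_sym (negPf nh) scale0r scaler0.
Qed.

Section Bicharacter.

Variable R : AA.
Hypothesis RU : R \is a GRing.unit.
Hypothesis R_id_Delta :
  gmap (fun p => (p.1, p.2, p.2)) R =
  gmap (fun p => (p.1, 1%g, p.2)) R * gmap (fun p => (p.1, p.2, 1%g)) R.
Hypothesis R_Delta_id :
  gmap (fun p => (p.1, p.1, p.2)) R =
  gmap (fun p => (p.1, 1%g, p.2)) R * gmap (fun p => (1%g, p.1, p.2)) R.

(** Apply [id (x) delta_z (x) delta_y] to [(id (x) Delta) R = R_13 R_12]; on the left only equal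
    second and third legs occur. *)
Lemma lslice_orth y z : lslice R y * lslice R z = (y == z)%:R *: lslice R y.
Proof.
pose f (t : gT * gT * gT) : A := ((t.1.2 == z) && (t.2 == y))%:R *: ge t.1.1.
have := congr1 (glin f) R_id_Delta; rewrite glin_gmapM glin_gmap => E.
transitivity (glin (fun p => f (p.1, p.2, p.2)) R).
  rewrite E mul_glin; apply: eq_bigr => p _; apply: eq_bigr => q _.
  rewrite /f /= mulg1 mul1g; congr (_ *: _).
  by rewrite -scalerAl -scalerAr scalerA -natrM mulnb geM andbC.
rewrite /lslice /glin scaler_sumr; apply: eq_bigr => p _.
rewrite /f /= !scalerA; case: (eqVneq p.2 y) => [->|_]; last by rewrite andbF !mulr0.
by rewrite andbT mulr1 mulrC.
Qed.

Lemma rslice_orth x y : rslice R x * rslice R y = (x == y)%:R *: rslice R x.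
Proof.
pose f (t : gT * gT * gT) : A := ((t.1.1 == x) && (t.1.2 == y))%:R *: ge t.2.
have := congr1 (glin f) R_Delta_id; rewrite glin_gmapM glin_gmap => E.
transitivity (glin (fun p => f (p.1, p.1, p.2)) R).
  rewrite E mul_glin; apply: eq_bigr => p _; apply: eq_bigr => q _.
  rewrite /f /= mulg1 mul1g; congr (_ *: _).
  by rewrite -scalerAl -scalerAr scalerA -natrM mulnb geM.
rewrite /rslice /glin scaler_sumr; apply: eq_bigr => p _.
rewrite /f /= !scalerA; case: (eqVneq p.1 x) => [->|_]; last by rewrite !mulr0.
by rewrite mulr1 mulrC.
Qed.

(** Applying the counit to the last two slots of [R_id_Delta] shows that this element is idempotent,
    and an idempotent unit is 1. *)
Lemma R_counitr : gmap fst R = 1.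
Proof.
have fstM : {morph (@fst gT gT) : p q / (p * q)%g} by [].
apply: (mulrI (gmap_unit fstM RU)); rewrite mulr1.
have sM : {morph (fun t : gT * gT * gT => t.1.1) : p q / (p * q)%g} by [].
exact: esym (etrans (esym (gmap_comp _ _ _))
  (etrans (congr1 _ R_id_Delta) (gmapM_comp _ _ _ _ sM))).
Qed.

Lemma R_counitl : gmap snd R = 1.
Proof.
have sndM : {morph (@snd gT gT) : p q / (p * q)%g} by [].
apply: (mulrI (gmap_unit sndM RU)); rewrite mulr1.
have sM : {morph (fun t : gT * gT * gT => t.2) : p q / (p * q)%g} by [].
exact: esym (etrans (esym (gmap_comp _ _ _))
  (etrans (congr1 _ R_Delta_id) (gmapM_comp _ _ _ _ sM))).
Qed.

(** Apply [x (x) y (x) z |-> S(x) y (x) z], with [S] the antipode, to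
    [(Delta (x) id) R = R_13 R_23]; the left side collapses to the counit. *)
Lemma R_antipode : gmap (fun p => (p.1^-1, p.2)%g) R * R = 1.
Proof.
pose f (t : gT * gT * gT) : AA := ge (t.1.1^-1 * t.1.2, t.2)%g.
have := congr1 (glin f) R_Delta_id; rewrite glin_gmapM glin_gmap => E.
rewrite -{2}[R]gmap_id mul_glin.
transitivity (glin (fun p => f (p.1, p.1, p.2)) R).
  rewrite E; apply: eq_bigr => p _; apply: eq_bigr => q _.
  by rewrite /f /= mulg1 mul1g -geM.
transitivity (gmap (fun g : gT => (1%g : gT, g)) (gmap snd R)).
  by rewrite gmap_comp; apply: eq_bigr => p _; rewrite /f /= mulVg.
by rewrite R_counitl gmap1 // => x y; congr (_, _); rewrite mulg1.
Qed.

(** Both [R_21] and [(S (x) id) R] are left inverses of the unit [R], hence equal; compare their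
    coefficients at [(g, h)]. *)
Lemma R_coefC g h : swap R * R = 1 -> R@_((h, g)) = R@_((g^-1, h)%g).
Proof.
move=> Rs; have sE : swap R = gmap (fun p => (p.1^-1, p.2)%g) R.
  by apply: (mulIr RU); rewrite Rs R_antipode.
have /(congr1 (fun X : AA => X@_((g, h)))) := sE.
have swI : injective (@leg_swap gT) by move=> [? ?] [? ?] [-> ->].
have inI : injective (fun p : gT * gT => (p.1^-1, p.2)%g).
  by move=> [? ?] [? ?] /= [/invg_inj -> ->].
rewrite -[(g, h) in LHS]/(leg_swap (h, g)) coef_gmap // => ->.
by rewrite -{1}[g]invgK
  -[(_, h) in LHS]/((fun p : gT * gT => (p.1^-1, p.2)%g) (g^-1, h)%g) coef_gmap.
Qed.

End Bicharacter.

End Slices.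

(** * Contracting the two legs through the antipode *)

Section Kappa.

Variables (k : fieldType) (gT : finGroupType).
Local Notation A := (galg k gT).
Local Notation AA := (galg k (gT * gT)%type).

Definition kappa : AA -> A := glin (fun p => ge (p.1^-1 * p.2)%g).

Section Invariant.

Variable F : AA.
Hypothesis FC : forall a : A, Delta a * F = F * Delta a.

(** Applying [kappa] to [Delta(x) F = F Delta(x)] gives [kappa(F)] on the left and [x^-1 kappa(F) x]
    on the right. *)
Lemma kappa_central x : ge x * kappa F = kappa F * ge x.
Proof.
have := congr1 kappa (FC (ge x)); rewrite Delta_ge -{1 2}[F]gmap_id.
rewrite -[ge (x, x)](gmap_id (ge _)) /kappa !glin_gmapM.
move=> E; have {E} : glin (fun p : gT * gT => ge (p.1^-1 * p.2)%g) F =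
    \sum_p F@_p *: (ge x^-1%g * ge (p.1^-1 * p.2)%g * ge x) :> A.
  move: E; rewrite (bigD1 (x, x)) //= [X in _ + X]big1 => [|p np]; last first.
    by rewrite big1 // => q _; rewrite coef_ge (negPf np) mul0r scale0r.
  rewrite addr0 => E; rewrite /glin; transitivity
    (\sum_q ((ge (x, x) : AA)@_((x, x)) * F@_q) *: (ge ((x * q.1)^-1 * (x * q.2))%g : A)).
    apply: eq_bigr => q _; rewrite coef_ge eqxx mul1r invMg.
    by rewrite -mulgA mulKg.
  rewrite E; apply: eq_bigr => p _; rewrite (bigD1 (x, x)) //= big1 => [|q nq].
    rewrite addr0 coef_ge eqxx mulr1; congr (_ *: _).
    by rewrite -!geM invMg !mulgA.
  by rewrite coef_ge (negPf nq) mulr0 scale0r.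
move=> E; rewrite /kappa {1}E mulr_sumr /glin mulr_suml; apply: eq_bigr => p _.
by rewrite -scalerAr -scalerAl !mulrA -geM mulgV ge1 mul1r.
Qed.

(** The antipode reverses products, so a term [g (x) h] of [Y] contributes [g^-1 kappa(F) h], and
    [kappa(F)] is central. *)
Lemma kappaM Y : kappa (F * Y) = kappa F * kappa Y.
Proof.
rewrite /kappa -{1}[F]gmap_id -{1}[Y]gmap_id glin_gmapM exchange_big /=.
rewrite [in RHS]/glin mulr_sumr; apply: eq_bigr => q _.
transitivity (Y@_q *: (ge q.1^-1%g * kappa F * ge q.2)).
  rewrite /kappa /glin mulr_sumr mulr_suml scaler_sumr; apply: eq_bigr => p _.
  rewrite -scalerAr -scalerAl scalerA mulrC -!geM; congr (_ *: ge _).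
  by rewrite invMg !mulgA.
by rewrite kappa_central -mulrA -geM scalerAr.
Qed.

Lemma kappa1 : kappa 1 = 1.
Proof. by rewrite -ge1 /kappa glin_ge /= mulg1 invg1. Qed.

Lemma kappa_swap :
  kappa (swap F) = glin (fun p => ge (p.1 * p.2^-1)%g) F.
Proof.
(* Conjugating both legs by the second one fixes the second leg, so this reindexing preserves the
   coefficients of the invariant [F]. *)
pose h (p : gT * gT) := (p.1 ^ p.2, p.2)%g.
have hI : injective h by move=> [a b] [c d] /= [/[swap] <- /conjg_inj ->].
rewrite /kappa glin_gmap /glin [RHS](reindex_inj hI); apply: eq_bigr => p _ /=.
have -> : F@_((p.1 ^ p.2, p.2)%g) = F@_p.
  have jj : (p.2 ^ p.2 = p.2)%g by rewrite conjgE mulKg.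
  by rewrite -{2}jj invariant_coef // -surjective_pairing.
by rewrite conjgE !mulgA mulgK.
Qed.

Hypothesis FU : F \is a GRing.unit.

Lemma kappa_unit : kappa F \is a GRing.unit.
Proof.
have E : kappa F * kappa F^-1 = 1 by rewrite -kappaM mulrV // kappa1.
apply/unitrP; exists (kappa F^-1); split=> //.
rewrite -[LHS]/(kappa F^-1 * kappa F) [kappa F^-1]galgE mulr_suml.
by rewrite -[RHS]E [kappa F^-1 in RHS]galgE mulr_sumr; apply: eq_bigr => g _;
  rewrite -scalerAl -scalerAr kappa_central.
Qed.

Hypothesis tw :
  gmap (fun p => (p.1, p.2, 1%g)) F * gmap (fun p => (p.1, p.1, p.2)) F =
  gmap (fun p => (1%g, p.1, p.2)) F * gmap (fun p => (p.1, p.2, p.2)) F.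

(** The counit on the middle slot of the twist equation, after cancelling [F], gives [(id (x)
    eps)(F) (x) 1 = 1 (x) (eps (x) id)(F)]. Both contractions are therefore the scalar
    [(eps (x) eps)(F)]. *)
Lemma twist_counit : gmap snd F = gmap (fun=> 1%g : gT) F /\
  gmap fst F = gmap (fun=> 1%g : gT) F.
Proof.
have sM : {morph (fun t : gT * gT * gT => (t.1.1, t.2)) : p q / (p * q)%g} by [].
have E : gmap (fun p => (p.1, 1%g)) F = gmap (fun p => (1%g : gT, p.2)) F.
  apply: (mulIr FU); rewrite -{2 4}[F]gmap_id.
  have := etrans (esym (gmapM_comp _ _ _ _ sM))
    (etrans (congr1 _ tw) (gmapM_comp _ _ _ _ sM)).
  have i1 : gmap (fun p : gT * gT => (p.1, p.2)) F = gmap id F.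
    by apply: eq_bigr => -[].
  by rewrite i1.
split.
  by have := congr1 (gmap snd) E; rewrite !gmap_comp => <-.
by have := congr1 (gmap fst) E; rewrite !gmap_comp => ->.
Qed.

(** Under [x (x) y (x) z |-> x S(y) z] the two sides of the twist equation become [kappa(F_21) c]
    and [kappa(F) c], where [c = (eps (x) eps)(F)] is a nonzero scalar. *)
Lemma kappa_twist : kappa (swap F) = kappa F.
Proof.
have [Es Ef] := twist_counit.
pose c := \sum_p F@_p; have cE : gmap (fun=> 1%g : gT) F = c%:A.
  by rewrite /gmap /glin scaler_suml.
have cU : c%:A \is a @GRing.unit A.
  by rewrite -cE -Ef gmap_unit.
pose f (t : gT * gT * gT) : A := ge (t.1.1 * t.1.2^-1 * t.2)%g.
have := congr1 (glin f) tw; rewrite !glin_gmapM => E.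
rewrite kappa_swap; apply: (mulIr cU); rewrite -{1}cE -Es mul_glin.
transitivity (\sum_p \sum_q (F@_p * F@_q) *: f ((p.1, p.2, 1%g) * (q.1, q.1, q.2))%g).
  apply: eq_bigr => p _; apply: eq_bigr => q _; rewrite /f /= mul1g -geM.
  by congr (_ *: ge _); rewrite invMg !mulgA mulgK.
rewrite E exchange_big /=.
transitivity (\sum_q F@_q *: (ge (q.1 * q.2^-1)%g * kappa F * ge q.2)).
  apply: eq_bigr => q _; rewrite /kappa /glin mulr_sumr mulr_suml scaler_sumr.
  apply: eq_bigr => p _; rewrite -scalerAr -scalerAl scalerA mulrC -!geM.
  by congr (_ *: ge _); rewrite /= mul1g invMg !mulgA.
rewrite -cE -Ef mulr_sumr; apply: eq_bigr => q _.
by rewrite kappa_central -mulrA -geM mulgKV scalerAr.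
Qed.

End Invariant.

Lemma kappa_Rmat F : F \is a GRing.unit -> (forall a : A, Delta a * F = F * Delta a) ->
  gmap (fun p => (p.1, p.2, 1%g)) F * gmap (fun p => (p.1, p.1, p.2)) F =
  gmap (fun p => (1%g, p.1, p.2)) F * gmap (fun p => (p.1, p.2, p.2)) F ->
  kappa (Rmat F) = 1.
Proof.
move=> FU FC tw; apply: (mulrI (kappa_unit FC FU)); rewrite mulr1.
by rewrite -{1}(kappa_twist FC FU tw) -(kappaM (swap_invariant FC)) RmatE.
Qed.

End Kappa.

(** * The bicharacter of an R-matrix *)

Section Characters.

Variables (k : closedFieldType) (gT : finGroupType) (H : {group gT}).

(** Extension by zero lets a character act on all of [k[gT]] through [glin]; it is multiplicative
    only on [H]. *)
Definition char_ext (chi : dual k H) (g : gT) : k :=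
  if g \in H then ugval (dval chi (subg H g)) else 0.

Lemma char_extM chi : {in H &, {morph char_ext chi : x y / (x * y)%g >-> x * y}}.
Proof.
move=> x y Hx Hy; rewrite /char_ext groupM // Hx Hy -[RHS]/(ugval (_ * _)%g).
by congr ugval; rewrite -(is_charP _ (dvalP chi)) subgM.
Qed.

Lemma char_ext1 chi : char_ext chi 1%g = 1.
Proof.
rewrite /char_ext group1; have -> : subg H 1 = 1%g by exact: morph1.
have M := is_charP _ (dvalP chi).
suff -> : dval chi 1%g = 1%g by [].
by apply: (mulgI (dval chi 1%g)); rewrite -M !mulg1.
Qed.

Lemma char_ext_unit chi g : g \in H -> char_ext chi g != 0.
Proof.
by move=> Hg; rewrite /char_ext Hg -unitfE ugvalP.
Qed.

Lemma char_ext_mul chi psi g :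
  char_ext (chi * psi)%g g = char_ext chi g * char_ext psi g.
Proof.
rewrite /char_ext; case: ifP => _; last by rewrite mul0r.
by have -> : dval (chi * psi)%g (subg H g) = (dval chi (subg H g) * dval psi (subg H g))%g;
  first exact: ffunE.
Qed.

Lemma char_ext_one g : char_ext 1%g g = (g \in H)%:R.
Proof.
rewrite /char_ext; case: ifP => //= _.
by have -> : dval (1%g : dual k H) (subg H g) = 1%g; first exact: ffunE.
Qed.

Lemma char_ext_eq1 chi : (forall g, g \in H -> char_ext chi g = 1) -> chi = 1%g.
Proof.
move=> chi1; apply/val_inj/ffunP => x; apply: val_inj => /=.
have := chi1 _ (subgP x); rewrite /char_ext subgP sgvalK => ->.
by rewrite ffunE.
Qed.

Hypotheses (char_k : [pchar k] =i pred0) (abH : abelian H).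

(* A common eigenvector of [H] in the image of [a - 1] carries a character that
   is nontrivial at [a]. *)
Lemma dual_separates a : a \in H -> (forall chi, char_ext chi a = 1) -> a = 1%g.
Proof.
move=> Ha chi1; apply/eqP; apply/contraT => na.
pose T (i : [subg H]) : {linear galg k gT -> galg k gT} :=
  glin (fun g => ge (val i) * ge g : galg k gT).
pose e : {linear galg k gT -> galg k gT} :=
  glin (fun g => (ge a - 1) * ge g : galg k gT).
have TE i x : T i x = ge (val i) * x by exact: glin_mull.
have eE x : e x = (ge a - 1) * x by exact: glin_mull.
have geC x y : x \in H -> y \in H -> ge x * ge y = ge y * ge x :> galg k gT.
  by move=> Hx Hy; rewrite -!geM (centsP abH).
have [|||v nzv /choice[c cP]] :=
    @commuting_eigenvector_image k _ [subg H] T e (1 : galg k gT).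
- by move=> i j x; rewrite !TE !mulrA geC ?subgP.
- move=> i x; rewrite TE !eE TE !mulrA; congr (_ * _).
  by rewrite mulrBr mulrBl mulr1 mul1r geC ?subgP.
- by rewrite eE mulr1 subr_eq0 -ge1 (inj_eq (@ge_inj k gT)).
have {}cP i : ge (val i) * e v = c i *: e v by rewrite -TE.
have cU i : c i \is a GRing.unit.
  rewrite unitfE; apply: contraNneq nzv => c0; move: (cP i).
  rewrite c0 scale0r => /(congr1 (fun x => (ge (val i))^-1 * x)).
  by rewrite mulrA mulVr ?ge_unit // mul1r mulr0 => ->.
pose chi := [ffun i => Ugroup (cU i)].
have chiP : chi \in @is_char k gT H.
  apply/is_charP => i j; apply: val_inj; rewrite !ffunE /=.
  apply/eqP; rewrite -subr_eq0 -(orbF (_ == 0)) -(negPf nzv) -scaler_eq0.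
  rewrite scalerBl subr_eq0 -cP -scalerA -cP scalerAr -cP mulrA.
  by rewrite geC ?subgP // -geM.
have ea : ge a * e v = e v.
  have := chi1 (Dual chiP); rewrite /char_ext Ha /= ffunE /= => c1.
  by have := cP (subg H a); rewrite c1 scale1r /= subgK.
have an : (ge a : galg k gT) ^+ #[a]%g = 1.
  rewrite -ge1 -(expg_order a); elim: #[a]%g => [|n IHn]; first by rewrite expr0.
  by rewrite exprS expgS geM IHn.
(* The sum of the powers of [a] kills the image of [a - 1], but acts on the fixed vector [e v] as
   the order of [a], which is nonzero in characteristic zero. *)
have : (\sum_(i < #[a]%g) ge a ^+ i) * e v = 0 :> galg k gT.
  have ca : (ge a - 1) * (\sum_(i < #[a]%g) ge a ^+ i) =
            (\sum_(i < #[a]%g) ge a ^+ i) * (ge a - 1) :> galg k gT.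
    rewrite mulr_suml mulr_sumr; apply: eq_bigr => i _.
    by rewrite mulrBl mulrBr mulr1 mul1r -exprS -exprSr.
  by rewrite eE mulrA -ca -subrX1 an subrr mul0r.
have -> : (\sum_(i < #[a]%g) ge a ^+ i) * e v = #[a]%g%:R *: e v :> galg k gT.
  rewrite mulr_suml -[#[a]%g in RHS]card_ord scaler_nat -sumr_const.
  apply: eq_bigr => i _; elim: (i : nat) => [|n IHn]; first by rewrite mul1r.
  by rewrite exprSr -mulrA ea.
move/eqP; rewrite scaler_eq0 (negPf nzv) orbF.
by rewrite ((pcharf0P k).1 char_k) -[_ == 0%N]negbK -lt0n order_gt0.
Qed.

End Characters.

(** * From an R-matrix to an invariant alternating form *)

Section BicharacterForm.

Variables (k : closedFieldType) (gT : finGroupType).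
Local Notation A := (galg k gT).
Local Notation AA := (galg k (gT * gT)%type).

Hypothesis char_k : [pchar k] =i pred0.
Variable R : AA.
Hypothesis RU : R \is a GRing.unit.
Hypothesis RC : forall a : A, Delta a * R = R * Delta a.
Hypothesis R_swap : swap R * R = 1.
Hypothesis R_id_Delta :
  gmap (fun p => (p.1, p.2, p.2)) R =
  gmap (fun p => (p.1, 1%g, p.2)) R * gmap (fun p => (p.1, p.2, 1%g)) R.
Hypothesis R_Delta_id :
  gmap (fun p => (p.1, p.1, p.2)) R =
  gmap (fun p => (p.1, 1%g, p.2)) R * gmap (fun p => (1%g, p.1, p.2)) R.
Hypothesis kappaR : kappa R = 1.

Let l := lslice R.
Let RcoefC g h : R@_((h, g)) = R@_((g^-1, h)%g).
Proof. exact: R_coefC. Qed.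

(** The coefficient form of [Delta(l m) = \sum_h l h (x) l (h^-1 * m)]. *)
Lemma R_comult g g' m :
  \sum_h R@_((g, h)) * R@_((g', h^-1 * m)%g) = (g == g')%:R * R@_((g, m)).
Proof.
have := congr1 (fun x : A => x@_m) (rslice_orth R_Delta_id g g').
rewrite coefM coefZ coef_rslice => <-.
by apply: eq_bigr => h _; rewrite !coef_rslice.
Qed.

Lemma lslice_neq0P h : reflect (exists g, R@_((g, h)) != 0) (l h != 0).
Proof.
apply: (iffP idP) => [|[g]]; last first.
  by apply: contraNneq => l0; rewrite -coef_lslice -/l l0 coef0.
apply: contra_neqP => /forallNP R0; apply/galgP => g.
by rewrite coef_lslice coef0; apply/eqP/negbNE/negP/R0.
Qed.

Definition R_support : {set gT} := [set h | l h != 0].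

Lemma R_support_group_set : group_set R_support.
Proof.
apply/group_setP; split=> [|x y].
  rewrite inE; apply/lslice_neq0P; apply: contrapT => /forallNP R0.
  have /(congr1 (fun x : A => x@_(1%g))) := R_counitl RU R_Delta_id.
  rewrite -sum_rslice coef_sum -ge1 coef_ge eqxx big1 => [/esym/eqP|g _].
    by rewrite oner_eq0.
  by rewrite coef_rslice; apply/eqP/negbNE/negP/R0.
rewrite !inE => nzx nzy; apply: contraNneq nzx => xy0; apply/eqP.
(* The coproduct of [l (x * y)] is [\sum_h l h (x) l (h^-1 * (x * y))]; its
   product with [l x (x) l y] isolates one term. *)
have D0 : \sum_h tens (l h) (l (h^-1 * (x * y))%g) = 0 :> AA.
  apply/galgP => -[g g']; rewrite coef0 coef_sum.
  rewrite (eq_bigr (fun h => R@_((g, h)) * R@_((g', h^-1 * (x * y))%g))) => [|h _].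
    by rewrite R_comult -coef_lslice -/l xy0 coef0 mulr0.
  by rewrite coef_tens !coef_lslice.
have /eqP := congr1 (fun X => X * tens (l x) (l y)) D0.
rewrite mul0r mulr_suml (bigD1 x) //= big1 => [|h nh]; last first.
  rewrite -tensM !(lslice_orth R_id_Delta) (negPf nh) scale0r.
  by apply/galgP => p; rewrite coef_tens !coef0 mul0r.
rewrite addr0 mulKg -tensM !(lslice_orth R_id_Delta) !eqxx !scale1r => /eqP t0.
apply/galgP => g; rewrite coef0.
have /lslice_neq0P[g' nzg'] := nzy.
have /eqP := congr1 (fun X : AA => X@_((g, g'))) t0.
by rewrite coef_tens coef0 /= mulf_eq0 orbC coef_lslice (negPf nzg') => /eqP.
Qed.

Definition R_group := Group R_support_group_set.
Local Notation H := R_group.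

Lemma R_group_coefr g h : R@_((g, h)) != 0 -> h \in H.
Proof. by move=> nz; rewrite inE; apply/lslice_neq0P; exists g. Qed.

(** [H] is built from the second legs; the skew symmetry [RcoefC] turns a first leg into the inverse
    of a second leg. *)
Lemma R_group_coefl g h : R@_((g, h)) != 0 -> g \in H.
Proof.
by rewrite -[g]invgK -RcoefC => /R_group_coefr; rewrite !groupV.
Qed.

Lemma R_group_ex a : a \in H -> exists m, R@_((a, m)) != 0.
Proof.
rewrite inE => /lslice_neq0P[g]; rewrite -[g]invgK -RcoefC; by exists g^-1%g.
Qed.

(** This is [delta_a (x) id] applied to [Delta(l m)]. Together with [R_group_ex] it puts every
    element of [H] in the span of the idempotents [l h]. *)
Lemma lslice_comult a m :
  R@_((a, m)) *: ge a = \sum_h R@_((a, h)) *: l (h^-1 * m)%g.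
Proof.
apply/galgP => g; rewrite coefZ coef_ge coef_sum eq_sym mulrC -R_comult.
by apply: eq_bigr => h _; rewrite coefZ coef_lslice.
Qed.

(** The elements of [H] are linear combinations of the [l h], which commute. *)
Lemma R_group_abelian : abelian H.
Proof.
have lC y z : l y * l z = l z * l y.
  by rewrite !(lslice_orth R_id_Delta) eq_sym; case: eqVneq => [->|]; rewrite ?scale0r.
have geC (a : gT) (X : A) : a \in H -> (forall z, l z * X = X * l z) -> ge a * X = X * ge a.
  move=> /R_group_ex[m nzm] XC; apply: (scalerI nzm).
  rewrite scalerAl scalerAr lslice_comult mulr_suml mulr_sumr.
  by apply: eq_bigr => h _; rewrite -scalerAl -scalerAr XC.
apply/centsP => a Ha b Hb; apply: (@ge_inj k); rewrite !geM.
apply: (geC) => // z; apply/esym/(geC) => // z'; exact: lC.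
Qed.

Lemma R_group_normal : (H <| [set: gT])%g.
Proof.
apply/normalP; split=> [|x _]; first exact: subsetT.
apply/setP => a; rewrite mem_conjg !inE; apply/lslice_neq0P/lslice_neq0P => -[g nz].
  by exists (g ^ x)%g; rewrite -[a](conjgKV x) (invariant_coef _ _ _ RC).
by exists (g ^ x^-1)%g; rewrite (invariant_coef _ _ _ RC).
Qed.

Definition R_abnormal : abnormal gT :=
  @AbNormal gT H (introT andP (conj R_group_abelian R_group_normal)).

Local Notation D := (dual k R_abnormal).

Definition R_pairing (chi psi : D) : k :=
  \sum_p R@_p * (char_ext chi p.1 * char_ext psi p.2).

(** Coefficients of [R] vanish off [H], so identities such as multiplicativity of characters are
    required there only. *)
Let RM p q (f : gT * gT -> gT * gT -> k) (f' : gT * gT -> gT * gT -> k) :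
  (p.1 \in H -> p.2 \in H -> q.1 \in H -> q.2 \in H -> f p q = f' p q) ->
  R@_p * R@_q * f p q = R@_p * R@_q * f' p q.
Proof.
move=> ff; have [->|nzp] := eqVneq (R@_p) 0; first by rewrite !mul0r.
have [->|nzq] := eqVneq (R@_q) 0; first by rewrite mulr0 !mul0r.
case: p q nzp nzq ff => [p1 p2] [q1 q2] nzp nzq ff; rewrite ff //=.
- exact: R_group_coefl nzp.
- exact: R_group_coefr nzp.
- exact: R_group_coefl nzq.
- exact: R_group_coefr nzq.
Qed.

(** Evaluate [chi (x) chi' (x) psi] on [(Delta (x) id) R = R_13 R_23]. *)
Lemma R_pairingMl chi chi' psi :
  R_pairing (chi * chi')%g psi = R_pairing chi psi * R_pairing chi' psi.
Proof.
pose f (t : gT * gT * gT) : k^o :=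
  char_ext chi t.1.1 * char_ext chi' t.1.2 * char_ext psi t.2.
have := congr1 (glin f) R_Delta_id; rewrite glin_gmapM glin_gmap => E.
transitivity (glin (fun p => f (p.1, p.1, p.2)) R).
  by apply: eq_bigr => p _; rewrite char_ext_mul.
rewrite E mulr_suml; apply: eq_bigr => p _; rewrite mulr_sumr.
apply: eq_bigr => q _; rewrite mulrACA.
apply: (RM (f := fun p q => f _)
  (f' := fun p q => char_ext chi p.1 * char_ext psi p.2 *
                    (char_ext chi' q.1 * char_ext psi q.2))) => p1 p2 q1 q2.
by rewrite /f /= mulg1 mul1g char_extM // mulrACA.
Qed.

Lemma R_pairingMr chi psi psi' :
  R_pairing chi (psi * psi')%g = R_pairing chi psi * R_pairing chi psi'.
Proof.
(* In [R_13 R_12] the first factor ends in slot 3, so [psi] is evaluated there and [psi'] in slot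
   2. *)
pose f (t : gT * gT * gT) : k^o :=
  char_ext chi t.1.1 * (char_ext psi t.2 * char_ext psi' t.1.2).
have := congr1 (glin f) R_id_Delta; rewrite glin_gmapM glin_gmap => E.
transitivity (glin (fun p => f (p.1, p.2, p.2)) R).
  by apply: eq_bigr => p _; rewrite char_ext_mul.
rewrite E mulr_suml; apply: eq_bigr => p _; rewrite mulr_sumr.
apply: eq_bigr => q _; rewrite mulrACA.
apply: (RM (f := fun p q => f _)
  (f' := fun p q => char_ext chi p.1 * char_ext psi p.2 *
                    (char_ext chi q.1 * char_ext psi' q.2))) => p1 p2 q1 q2.
by rewrite /f /= mulg1 mul1g char_extM // mulrACA.
Qed.

Lemma R_pairing1l psi : R_pairing 1%g psi = 1.
Proof.
have := congr1 (glin (char_ext psi : gT -> k^o)) (R_counitl RU R_Delta_id).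
rewrite glin_gmap -ge1 glin_ge char_ext1 => <-; apply: eq_bigr => -[g h] _.
rewrite char_ext_one /=; have [->|nz] := eqVneq (R@_((g, h))) 0.
  by rewrite mul0r scale0r.
by rewrite (R_group_coefl nz) mul1r.
Qed.

Lemma R_pairing_unit chi psi : R_pairing chi psi \is a GRing.unit.
Proof.
rewrite unitfE; apply/eqP => b0; have /eqP := R_pairing1l psi.
by rewrite -(mulgV chi) R_pairingMl b0 mul0r eq_sym oner_eq0.
Qed.

Definition R_form (chi psi : D) : ugroup k := Ugroup (R_pairing_unit chi psi).

Lemma R_form_bilinear : bilinear_form R_form.
Proof.
split=> [psi chi chi'|chi psi psi']; apply: val_inj.
  exact: R_pairingMl.
exact: R_pairingMr.
Qed.

(** Applying [chi] to [kappa(R) = 1] yields [b(chi^-1, chi) = 1], and bilinearity finishes. *)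
Lemma R_form_alternating : alternating_form R_form.
Proof.
move=> chi; apply: val_inj; rewrite /=.
have bV : R_pairing chi^-1%g chi = 1.
  have := congr1 (glin (char_ext chi : gT -> k^o)) kappaR.
  rewrite -ge1 glin_ge char_ext1 => <-.
  rewrite /kappa (glin_gmap (char_ext chi : gT -> k^o) (fun p : gT * gT => p.1^-1 * p.2)%g).
  apply: eq_bigr => -[g h] _.
  have [->|nz] := eqVneq (R@_((g, h))) 0; first by rewrite mul0r scale0r.
  have Hg := R_group_coefl nz; have Hh := R_group_coefr nz.
  congr (_ * _); rewrite /= char_extM ?groupV //; congr (_ * _).
  apply: (mulfI (char_ext_unit chi Hg)); rewrite -char_extM ?groupV // mulgV char_ext1.
  by rewrite -char_ext_mul mulgV char_ext_one Hg.
by rewrite -[LHS]mul1r -{1}bV -R_pairingMl mulVg R_pairing1l.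
Qed.

Lemma R_form_invariant : invariant_form R_form.
Proof.
move=> g chi psi; apply: val_inj; rewrite /= /R_pairing.
pose c (p : gT * gT) := (p.1 ^ g, p.2 ^ g)%g.
have cI : injective c by move=> [a b] [a' b'] /= [/conjg_inj -> /conjg_inj ->].
have actE (x : D) a : char_ext (dual_act g x) a = char_ext x (a ^ g)%g.
  have nH : (a ^ g \in H)%g = (a \in H).
    by rewrite memJ_norm // (subsetP (normal_norm R_group_normal)) ?inE.
  rewrite /char_ext nH; case: ifP => // Ha; rewrite ffunE; congr (ugval (dval x _)).
  by apply: val_inj; rewrite val_conj_subg /= !subgK // nH.
rewrite [RHS](reindex_inj cI); apply: eq_bigr => -[a b] _ /=.
by rewrite !actE (invariant_coef _ _ _ RC).
Qed.

(** The scalars [c h = chi(l h)] are orthogonal idempotents of sum 1 in a field, so exactly one,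
    [c h0], is nonzero and [b(chi, psi) = psi(h0)]. If this is 1 for all [psi], separation of points
    forces [h0 = 1]. *)
Lemma R_form_nondegenerate : nondegenerate_form R_form.
Proof.
have nl chi : (forall psi, R_form chi psi = 1%g) -> chi = 1%g.
  move=> b1; pose c h := \sum_g R@_((g, h)) * char_ext chi g.
  have cE h : c h = glin (char_ext chi : gT -> k^o) (l h).
    by apply: eq_bigr => g _; rewrite coef_lslice.
  have cM h h' : c h * c h' = (h == h')%:R * c h.
    pose f : gT -> k^o := char_ext chi.
    have := congr1 (glin f) (lslice_orth R_id_Delta h h').
    rewrite linearZ_LR /= -!cE => E; rewrite -[RHS]E {E} !cE.
    rewrite -[lslice R h]gmap_id -[lslice R h']gmap_id glin_gmapM mulr_suml.
    apply: eq_bigr => g _; rewrite mulr_sumr; apply: eq_bigr => g' _.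
    rewrite mulrACA !coef_lslice.
    apply: (RM (p := (g, h)) (q := (g', h')) (f := fun p q => char_ext chi p.1 * char_ext chi q.1)
      (f' := fun p q => f (p.1 * q.1)%g)) => /= *; exact/esym/char_extM.
  have c1 : \sum_h c h = 1.
    have := congr1 (glin (char_ext chi : gT -> k^o)) (R_counitr RU R_id_Delta).
    rewrite -sum_lslice linear_sum /= -ge1 glin_ge char_ext1 => <-.
    by apply: eq_bigr => h _; rewrite cE.
  have bE psi : R_pairing chi psi = \sum_h c h * char_ext psi h.
    transitivity (\sum_g \sum_h R@_((g, h)) * (char_ext chi g * char_ext psi h)).
      by rewrite pair_bigA; apply: eq_bigr => -[].
    rewrite exchange_big; apply: eq_bigr => h _; rewrite mulr_suml.
    by apply: eq_bigr => g _; rewrite mulrA.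
  have [h0 nz0] : exists h0, c h0 != 0.
    apply: contrapT => /forallNP c0; have /eqP := c1; rewrite big1 => [|h _].
      by rewrite eq_sym oner_eq0.
    by apply/eqP/negbNE/negP/c0.
  have ch h : h != h0 -> c h = 0.
    move=> nh; have /eqP := cM h h0; rewrite (negPf nh) mul0r mulf_eq0 (negPf nz0) orbF.
    by move/eqP.
  have c01 : c h0 = 1 by rewrite -c1 (bigD1 h0) //= big1 ?addr0.
  have H0 : h0 \in H.
    rewrite inE; apply: contraNneq nz0 => l0; rewrite cE l0 linear0. exact: eqxx.
  have h01 : h0 = 1%g.
    apply: (dual_separates char_k R_group_abelian H0) => psi.
    have /(congr1 (@ugval k)) := b1 psi; rewrite /= bE (bigD1 h0) //= big1 => [|h nh].
      by rewrite addr0 c01 mul1r.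
    by rewrite ch ?mul0r.
  (* Apply [chi] to [lslice_comult]: since [c] is supported at 1, only the term [h = m] survives,
     whence [chi(a) = 1]. *)
  apply: char_ext_eq1 => a /R_group_ex[m nzm]; apply: (mulfI nzm); rewrite mulr1.
  have := congr1 (glin (char_ext chi : gT -> k^o)) (lslice_comult a m).
  rewrite linearZ_LR /= glin_ge => E; rewrite [LHS]E {E}.
  rewrite linear_sum (bigD1 m) //= big1 => [|h nh].
    by rewrite linearZ_LR /= mulVg -cE -h01 c01 addr0 -[LHS]/(_ * _) mulr1.
  rewrite linearZ_LR /= -cE ch ?scaler0 //; apply: contraNneq nh => e.
  by apply/eqP; rewrite -[m](mulKVg h) e h01 mulg1.
split=> [|psi b1]; first exact: nl.
(* Expanding [b(psi chi, psi chi) = 1] reduces the right radical to the left one. *)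
have [bl br] := R_form_bilinear; have alt := R_form_alternating.
apply: nl => chi; have := alt (psi * chi)%g.
by rewrite bl !br !alt b1 mul1g !mulg1.
Qed.

(** The pair built from [R] is the trivial one, so [H] is trivial, every second leg is 1, and
    [R = (id (x) eps)(R) (x) 1]. *)
Lemma R_trivial : calB k gT = [set calB_one k gT]%classic -> R = 1.
Proof.
move=> Btriv.
have : calB k gT (existT _ R_abnormal R_form).
  split; [exact: R_form_bilinear|exact: R_form_alternating
         |exact: R_form_nondegenerate|exact: R_form_invariant].
rewrite Btriv => /= E; have {}E : R_abnormal = projT1 (calB_one k gT) by rewrite -E.
have H1 : H = [1 gT]%G by have := congr1 (@abn_group gT) E.
transitivity (gmap (fun g : gT => (g, 1%g : gT)) (gmap fst R)); last first.
  rewrite (R_counitr RU R_id_Delta) gmap1 // => x y; congr (_, _); by rewrite mulg1.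
rewrite gmap_comp -[LHS]gmap_id; apply: eq_bigr => -[g h] _ /=.
have [->|nz] := eqVneq (R@_((g, h))) 0; first by rewrite !scale0r.
by have := R_group_coefr nz; rewrite H1 => /set1P ->.
Qed.

End BicharacterForm.

(** * Symmetric twists *)

Section SliceProducts.

Variables (k : fieldType) (gT : finGroupType).
Local Notation A := (galg k gT).
Local Notation AA := (galg k (gT * gT)%type).

Lemma rslice_mull (x : A) (Y : AA) g : rslice (tens 1 x * Y) g = x * rslice Y g.
Proof.
have -> : tens 1 x = gmap (fun h : gT => (1%g : gT, h)) x.
  apply: (galg_ext (f := tens (1 : A)) (f' := gmap _)) => [||h].
  - exact: tens_linearr.
  - exact: gmap_linear.
  - by rewrite -ge1 tens_ge gmap_ge.
rewrite -{1}[Y]gmap_id /rslice glin_gmapM -{2}[x]gmap_id mul_glin.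
apply: eq_bigr => p _; apply: eq_bigr => q _ /=.
by rewrite mul1g -scalerAr -geM.
Qed.

Lemma rslice_mulr (x : A) (Y : AA) g : rslice (Y * tens 1 x) g = rslice Y g * x.
Proof.
have -> : tens 1 x = gmap (fun h : gT => (1%g : gT, h)) x.
  apply: (galg_ext (f := tens (1 : A)) (f' := gmap _)) => [||h].
  - exact: tens_linearr.
  - exact: gmap_linear.
  - by rewrite -ge1 tens_ge gmap_ge.
rewrite -{1}[Y]gmap_id /rslice glin_gmapM -{2}[x]gmap_id mul_glin.
apply: eq_bigr => p _; apply: eq_bigr => q _ /=.
by rewrite mulg1 -scalerAl -geM.
Qed.

Lemma rslice_Delta (x : A) g : rslice (Delta x) g = x@_g *: ge g.
Proof.
rewrite /rslice (glin_gmap _ (fun g : gT => (g, g))) /glin (bigD1 g) //= big1 => [|h nh].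
  by rewrite eqxx scale1r addr0.
by rewrite (negPf nh) scale0r scaler0.
Qed.

Lemma coef_Delta (x : A) g h : (Delta x)@_((g, h)) = (g == h)%:R * x@_g.
Proof. by rewrite -coef_rslice rslice_Delta coefZ coef_ge eq_sym mulrC. Qed.

End SliceProducts.

Section SymmetricTwist.

Variables (k : closedFieldType) (gT : finGroupType).
Local Notation A := (galg k gT).
Local Notation AA := (galg k (gT * gT)%type).

Variable F : AA.
Hypothesis FU : F \is a GRing.unit.
Hypothesis FC : forall a : A, Delta a * F = F * Delta a.

(** Slicing [Delta(a) = F^-1 (a (x) 1)(1 (x) a)] at [g] gives a left inverse up to a multiple of
    [g]; invariance moves [F^-1] to the other side and gives a right inverse. *)
Lemma coboundary_unit (a : A) : a != 0 -> F * Delta a = tens a a -> a \is a GRing.unit.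
Proof.
move=> nza Fa; have [g nzg] : exists g, a@_g != 0.
  apply: contrapT => /forallNP a0; case/eqP: nza; apply/galgP => g.
  by rewrite coef0; apply/eqP/negbNE/negP/a0.
pose c : A := a@_g *: ge g.
have cU : c \is a GRing.unit by rewrite scaler_unit ?ge_unit // unitfE.
have aE : tens a a = tens a 1 * tens 1 a by rewrite -tensM mulr1 mul1r.
have aE' : tens a a = tens 1 a * tens a 1 by rewrite -tensM mulr1 mul1r.
have L : rslice (F^-1 * tens a 1) g * a = c.
  by rewrite -rslice_mulr -mulrA -aE -Fa mulKr // rslice_Delta.
have R : a * rslice (tens a 1 * F^-1) g = c.
  by rewrite -rslice_mull mulrA -aE' -Fa -FC mulrK // rslice_Delta.
set y := rslice _ g in L; set z := rslice _ g in R.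
have ul : c^-1 * y * a = 1 by rewrite -mulrA L mulVr.
have ur : a * (z * c^-1) = 1 by rewrite mulrA R mulrV.
have yz : c^-1 * y = z * c^-1 
  by have := congr1 (fun w => w * (z * c^-1)) ul; rewrite -[X in X = _]mulrA ur mulr1 mul1r.
by apply/unitrP; exists (c^-1 * y); split=> //; rewrite yz.
Qed.

Hypothesis tw :
  gmap (fun p => (p.1, p.2, 1%g)) F * gmap (fun p => (p.1, p.1, p.2)) F =
  gmap (fun p => (1%g, p.1, p.2)) F * gmap (fun p => (p.1, p.2, p.2)) F.
Hypothesis Fs : swap F = F.

Let T (g : gT) : {linear A -> A} := glin (fun h => rslice (F * Delta (ge h)) g).
Let TE g x : T g x = rslice (F * Delta x) g.
Proof.
apply: (galg_ext (f := T g) (f' := fun x => rslice (F * Delta x) g)).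
- exact: glin_linear.
- by move=> c u v; rewrite Delta_linear mulrDr -scalerAr /rslice linearP.
- by move=> h; rewrite /T /= glin_ge.
Qed.

Let f (g h : gT) (t : gT * gT * gT) : A := ((t.1.1 == h) && (t.1.2 == g))%:R *: ge t.2.

(** The composite is [delta_h (x) delta_g (x) id] applied to [F_23 (id (x) Delta)(F Delta(x))],
    rewritten by the twist equation. *)
Let T_comp g h x : T g (T h x) =
  glin (f g h) (gmap (fun p => (p.1, p.2, 1%g)) F *
    gmap (fun p => (p.1, p.1, p.2)) F * gmap (fun u : gT => (u, u, u)) x).
Proof.
have sM : {morph (fun p : gT * gT => (p.1, p.2, p.2)) : p q / (p * q)%g} by [].
have := gmapM_comp id (fun u : gT => (u, u)) F x sM; rewrite gmap_id => E.
rewrite tw -mulrA -[X in gmap _ F * X]E {E} glin_gmapM !TE.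
rewrite -[gmap (fun u : gT => (u, u)) x]/(Delta x).
set Y := F * Delta x; set z := rslice Y h.
rewrite -[F]gmap_id -[Delta z]/(gmap (fun u : gT => (u, u)) z).
rewrite /rslice glin_gmapM gmap_id; apply: eq_bigr => p _.
transitivity (\sum_q1 \sum_q2 (F@_p * Y@_((q1, q2))) *:
    f g h ((1%g, p.1, p.2) * (q1, q2, q2))%g); last first.
  by rewrite pair_bigA; apply: eq_bigr => -[].
rewrite [RHS](bigD1 h) //= [X in _ = _ + X]big1 => [|q1 nq]; last first.
  by rewrite big1 // => q2 _; rewrite /f /= mul1g (negPf nq) scale0r scaler0.
by rewrite addr0; apply: eq_bigr => q2 _; rewrite /f /= mul1g eqxx coef_rslice.
Qed.

(** For symmetric [F] the element in [T_comp] is unchanged by exchanging its first two slots, which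
    exchanges [g] and [h]. *)
Let TC g h x : T g (T h x) = T h (T g x).
Proof.
rewrite !T_comp; pose s (t : gT * gT * gT) := (t.1.2, t.1.1, t.2).
have sM : {morph s : p q / (p * q)%g} by [].
set X := gmap _ F * gmap _ F * gmap _ x.
have -> : glin (f g h) X = glin (f h g) (gmap s X).
  by rewrite glin_gmap; apply: eq_bigr => t _; rewrite /f /= andbC.
congr glin; rewrite /X (gmapM sM) (gmapM_comp _ _ _ _ sM) gmap_comp.
by rewrite -{1}Fs gmap_comp.
Qed.

(* A joint eigenvector of the operators [(delta_g (x) id) (F * Delta x)] satisfies
   [F * Delta a = u (x) a], and the symmetry of [F] makes [u] proportional to [a]. *)
Lemma symmetric_twist_coboundary :
  exists2 a : A, a \is a GRing.unit & F = tens a a * Delta a^-1.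
Proof.
have [|||a nza /choice[c aT]] :=
  @commuting_eigenvector_image k A gT T idfun (1 : A).
- exact: TC.
- by [].
- exact: oner_neq0.
pose u : A := \sum_g c g *: ge g.
have uE g : u@_g = c g.
  rewrite coef_sum (bigD1 g) //= big1 => [|h nh]; rewrite coefZ coef_ge.
    by rewrite eqxx mulr1 addr0.
  by rewrite eq_sym (negPf nh) mulr0.
have FaE : F * Delta a = tens u a.
  apply/galgP => -[g h]; rewrite -coef_rslice -TE -[T g a]/(T g (idfun a)) aT.
  by rewrite coefZ coef_tens uE.
have swD : swap (Delta a) = Delta a.
  by rewrite gmap_comp.
have uaC g h : u@_g * a@_h = u@_h * a@_g.
  have swI : injective (@leg_swap gT) by move=> [? ?] [? ?] [-> ->].
  have /(congr1 (fun X : AA => X@_((g, h)))) : swap (F * Delta a) = F * Delta a.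
    by rewrite gmapM // Fs swD.
  rewrite FaE -[(g, h) in LHS]/(leg_swap (h, g)) coef_gmap //.
  by rewrite !coef_tens /= => ->.
have [g nzg] : exists g, a@_g != 0.
  apply: contrapT => /forallNP a0; case/eqP: nza; apply/galgP => g.
  by rewrite /= coef0; apply/eqP/negbNE/negP/a0.
(* From [F Delta(a) = r (a (x) a)], the rescaled [b = r a] satisfies [F Delta(b) = b (x) b]; [r] is
   nonzero since [F] is a unit and [Delta(a)] is nonzero. *)
pose r := u@_g / a@_g.
have ur : u = r *: a.
  apply/galgP => h; rewrite coefZ /r mulrAC uaC mulfK //.
have nzr : r != 0.
  apply/eqP => r0; have /(congr1 (fun X : AA => (F^-1 * X)@_((g, g)))) := FaE.
  rewrite mulKr // coef_Delta eqxx mul1r ur r0 scale0r => /eqP.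
  suff -> : tens 0 a = 0 :> AA by rewrite mulr0 coef0 (negPf nzg).
  by apply/galgP => p; rewrite coef_tens !coef0 mul0r.
have Fb : F * Delta (r *: a) = tens (r *: a) (r *: a).
  rewrite /Delta linearZ_LR /= -/(Delta a) -scalerAr FaE ur.
  by apply/galgP => p; rewrite coefZ !coef_tens !coefZ mulrCA.
have nzb : r *: a != 0 by rewrite scaler_eq0 negb_or nzr.
have bU := coboundary_unit nzb Fb.
exists (r *: a) => //; rewrite -Fb -mulrA -DeltaM mulrV // Delta1 mulr1 //.
Qed.

End SymmetricTwist.

(** * The isomorphism *)

Lemma first_isomorphism (W K : groupType) (N : normal_subgroup W) (f : W -> K) :
  {morph f : x y / (x * y)%g} -> (forall x, f x = 1%g <-> x \in (N : {pred W})) ->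
  (forall y, exists x, f x = y) -> group_iso (quotient_group N) K.
Proof.
move=> fM fN fS.
have fV x : f x^-1%g = (f x)^-1%g.
  have f1 : f 1%g = 1%g by apply: (mulgI (f 1%g)); rewrite -fM !mulg1.
  by apply: (mulgI (f x)); rewrite -fM !mulgV.
have fE x y : f x = f y <-> qpi N x = qpi N y.
  rewrite qpi_eq -fN fM fV; split=> [->|E]; first by rewrite mulVg.
  by apply: (mulgI (f x)^-1%g); rewrite mulVg.
pose g (q : quotient_group N) : K := f (generic_quotient.repr q).
have gE x : g (qpi N x) = f x.
  by apply/fE; rewrite /qpi generic_quotient.reprK.
have gM : {morph g : x y / (x * y)%g}.
  move=> q q'; have [x <-] := qpi_surj q; have [y <-] := qpi_surj q'.
  by rewrite -[(qpi N x * qpi N y)%g]/(qg_mul _ _) qpiM !gE.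
have [h hK] := choice fS.
pose gm : {multiplicative quotient_group N -> K} :=
  HB.pack g (isMultiplicative.Build _ _ g gM).
exists gm.
exists (fun y => qpi N (h y)) => [q|y] /=; last by rewrite gE.
by have [x <-] := qpi_surj q; rewrite gE; apply/fE.
Qed.

(** * Coboundaries of units and the normalizer of the group *)

Section Coboundaries.

Variables (k : fieldType) (gT : finGroupType).
Local Notation A := (galg k gT).
Local Notation AA := (galg k (gT * gT)%type).

(** The coefficients are orthogonal idempotents of [k], so a nonzero one equals 1 and excludes all
    others. *)
Lemma grouplike (x : A) : x != 0 -> Delta x = tens x x -> exists g, x = ge g.
Proof.
move=> nzx Dx; have [g nzg] : exists g, x@_g != 0.
  apply: contrapT => /forallNP x0; case/eqP: nzx; apply/galgP => g.
  by rewrite coef0; apply/eqP/negbNE/negP/x0.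
have xE h h' : (h == h')%:R * x@_h = x@_h * x@_h'.
  by rewrite -coef_Delta Dx coef_tens.
exists g; apply/galgP => h; apply: (mulfI nzg); rewrite -xE coef_ge eq_sym.
by rewrite mulrC; case: eqP => //; rewrite !mulr0.
Qed.

Definition coboundary (a : A) : AA := tens a a * Delta a^-1.

Lemma coboundaryK (a : A) : a \is a GRing.unit -> coboundary a * Delta a = tens a a.
Proof. by move=> aU; rewrite -mulrA -DeltaM mulVr // Delta1 mulr1. Qed.

Lemma coboundary_is_unit (a : A) :
  a \is a GRing.unit -> coboundary a \is a GRing.unit.
Proof. by move=> aU; rewrite unitrMl ?tens_unit // Delta_unit ?unitrV. Qed.

Lemma coboundary_twist (a : A) (aU : a \is a GRing.unit) :
  is_twist (Ugroup (coboundary_is_unit aU)).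
Proof.
have idM : {morph (fun x : A => x) : x y / x * y} by [].
rewrite /is_twist /= /coboundary (tens_mapM (@DeltaM k gT) idM).
rewrite (tens_mapM idM (@DeltaM k gT)) !tens_mapE; try exact: Delta_linear; try by [].
have e1 : tens (tens a a * Delta a^-1) (1 : A) * tens (Delta a) a = tens (tens a a) a.
  by rewrite -tensM mul1r coboundaryK.
have e2 : tens (1 : A) (tens a a * Delta a^-1) * tens a (Delta a) = tens a (tens a a).
  by rewrite -tensM mul1r coboundaryK.
by rewrite mulrA e1 mulrA e2 Delta_coassoc tens_assocM tens_assocE.
Qed.

(** Invariance of the second coboundary lets [Delta(a^-1)] pass it. *)
Lemma coboundaryM (a b : A) : a \is a GRing.unit -> b \is a GRing.unit ->
  (forall x : A, Delta x * coboundary b = coboundary b * Delta x) ->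
  coboundary (a * b) = coboundary a * coboundary b.
Proof.
move=> aU bU bC; have := bC a^-1; rewrite /coboundary => E.
by rewrite -[RHS]mulrA E invrM // DeltaM tensM !mulrA.
Qed.

Lemma coboundary_ge (a : A) h : a \is a GRing.unit ->
  coboundary (a * ge h) = coboundary a.
Proof.
move=> aU; rewrite /coboundary invrM ?ge_unit // DeltaM tensM.
rewrite -[LHS]mulrA; congr (_ * _); rewrite mulrA.
by rewrite tens_ge -Delta_ge -DeltaM mulrV ?ge_unit // Delta1 mul1r.
Qed.

(** Equal coboundaries make [b^-1 a] group-like. *)
Lemma coboundary_inj (a b : A) : a \is a GRing.unit -> b \is a GRing.unit ->
  coboundary a = coboundary b -> exists h, a = b * ge h.
Proof.
move=> aU bU ab; have := coboundaryK aU; rewrite ab /coboundary => E.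
have [||h xE] := @grouplike (b^-1 * a).
- by apply: contraTneq aU => x0; rewrite -[a](mulVKr bU) x0 mulr0 unitr0.
- rewrite DeltaM tensM -E -!mulrA mulrA -tensM mulVr // tens11 mul1r.
  by [].
by exists h; rewrite -xE mulVKr.
Qed.

Lemma normalizesP (a : ugroup A) : normalizes a <->
  (forall g, exists h, ugval a * ge g * (ugval a)^-1 = ge h) /\
  (forall g, exists h, (ugval a)^-1 * ge g * ugval a = ge h).
Proof.
have aU := ugvalP a; split=> [na|[n1 n2]].
  split=> g.
    have : range (@ge k gT) (ugval a * ge g * (ugval a)^-1).
      by rewrite -na; exists (ge g) => //; exists g.
    by move=> [h _ <-]; exists h.
  have : range (@ge k gT) (ge g) by exists g.
  rewrite -na => -[_ [h _ <-] <-]; exists h.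
  by rewrite -!mulrA mulVr // mulr1 mulrA mulVr // mul1r.
apply/seteqP; split=> x /=.
  by move=> [_ [g _ <-] <-]; have [h ->] := n1 g; exists h.
move=> [g _ <-]; have [h hE] := n2 g; exists (ge h); first by exists h.
by rewrite -hE !mulrA mulrV // mul1r mulrK.
Qed.

(** If [a^-1 g a = h], then [Delta(g)] passes [a (x) a] as [Delta(h)] and returns to [Delta(g)]
    across [Delta(a^-1)]. Conversely, commutation makes both conjugates of [g] group-like. *)
Lemma coboundary_invariant (a : ugroup A) : normalizes a <->
  forall x : A, Delta x * coboundary (ugval a) = coboundary (ugval a) * Delta x.
Proof.
have aU := ugvalP a; have CU := coboundary_is_unit aU.
rewrite normalizesP; split=> [[_ n2] x|aC].
  apply: (galg_ext (f := fun x => Delta x * coboundary (ugval a))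
                   (f' := fun x => coboundary (ugval a) * Delta x)) => [c u v|c u v|g].
  - by rewrite Delta_linear mulrDl -scalerAl.
  - by rewrite Delta_linear mulrDr -scalerAr.
  have [h hE] := n2 g.
  have ga : ge g * ugval a = ugval a * ge h by rewrite -hE !mulrA mulrV // mul1r.
  have ag : ge h * (ugval a)^-1 = (ugval a)^-1 * ge g.
    by rewrite -hE mulrK.
  rewrite /coboundary mulrA {1}Delta_ge -tens_ge -tensM ga tensM tens_ge -Delta_ge.
  by rewrite -!mulrA -!DeltaM ag.
have tU := tens_unit aU aU.
have nz (x : A) : x \is a GRing.unit -> x != 0.
  by move=> xU; apply: contraTneq xU => ->; rewrite unitr0.
split=> g; apply: grouplike.
- by apply: nz; rewrite !unitrMl ?unitrV ?ge_unit.
- apply: (mulIr CU); rewrite aC !DeltaM !mulrA coboundaryK // Delta_ge -tens_ge.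
  by rewrite -!tensM mulrVK.
- by apply: nz; rewrite !unitrMl ?unitrV ?ge_unit.
set y := _ * ugval a; have ay : ugval a * y = ge g * ugval a.
  by rewrite /y !mulrA mulrV // mul1r.
apply: (mulrI tU); rewrite -tensM ay -(coboundaryK aU) -mulrA -DeltaM ay DeltaM.
by rewrite mulrA -aC -mulrA coboundaryK // Delta_ge -tens_ge tensM.
Qed.

End Coboundaries.

(** * Twists and automorphisms *)

Section Correspondence.

Variables (k : closedFieldType) (gT : finGroupType).
Local Notation A := (galg k gT).
Local Notation AA := (galg k (gT * gT)%type).

(* Permutations compose on the right, so that conjugation by [a^-1], and not by
   [a], makes the correspondence multiplicative. *)
Definition twist_perm (z : Z2 k gT) (p : {perm gT}) : Prop :=
  exists a : ugroup A, [/\ normalizes a, ugval (Z2val z) = coboundary (ugval a) &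
    forall g, ge (p g) = (ugval a)^-1 * ge g * ugval a].

Lemma normalizesV (a : ugroup A) : normalizes a -> normalizes a^-1%g.
Proof. by move=> /normalizesP[n1 n2]; apply/normalizesP; rewrite /= invrK. Qed.

Lemma twist_perm_Int z p : twist_perm z p -> p \in Int k gT.
Proof.
move=> [a [/normalizesV na _ pE]]; apply/IntP; split; last first.
  by exists a^-1%g => // g; rewrite pE /= invrK.
rewrite inE; apply/andP; split; first by apply/subsetP => x _; rewrite inE.
apply/morphicP => x y _ _; apply: (@ge_inj k); rewrite geM !pE geM.
by rewrite !mulrA mulrK ?ugvalP.
Qed.

Lemma twist_perm_surj p : p \in Int k gT -> exists z, twist_perm z p.
Proof.
move=> /IntP[_ [a na pE]]; have {}na := normalizesV na.
have VU := ugvalP a^-1%g.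
have inZ : Ugroup (coboundary_is_unit VU) \in inv_twist (k:=k) (gT:=gT).
  by apply/inv_twistP; split; [exact: coboundary_twist | exact/coboundary_invariant].
by exists (MkZ2 inZ), a^-1%g; split=> // g; rewrite pE /= invrK.
Qed.

Lemma twist_permM z z' p p' :
  twist_perm z p -> twist_perm z' p' -> twist_perm (z * z')%g (p * p')%g.
Proof.
move=> [a [na zE pE]] [a' [na' zE' pE']]; exists (a * a')%g; split.
- exact: normalizesM.
- rewrite -[LHS]/(ugval (Z2val z) * ugval (Z2val z')) zE zE' /=.
  by rewrite coboundaryM ?ugvalP //; apply/coboundary_invariant.
- by move=> g; rewrite permM pE' pE /= invrM ?ugvalP // !mulrA.
Qed.

(** If [p] is conjugation by [h], then [a h] is central with the same coboundary as [a]. Conversely,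
    a central [c] with that coboundary satisfies [a = c h] for some [h] in the group. *)
Lemma twist_perm_B2 z p : twist_perm z p -> (p \in Inn gT) <-> (z \in B2 k gT).
Proof.
move=> [a [na zE pE]]; have aU := ugvalP a; split=> [/InnP[h ph]|].
  have cU : ugval a * ge h \is a GRing.unit by rewrite unitrMl ?ge_unit.
  have cC : Ugroup cU \in central_unit (k:=k) (gT:=gT).
    apply/central_unitP => b /=.
    apply: (galg_ext (f := fun b => ugval a * ge h * b)
                     (f' := fun b => b * (ugval a * ge h))) => [c u v|c u v|g].
    - by rewrite mulrDr -scalerAr.
    - by rewrite mulrDl -scalerAl.
    have ga : ge g * ugval a = ugval a * ge (h * g * h^-1)%g.
      by rewrite -ph pE !mulrA mulrV // mul1r.
    by rewrite [RHS]mulrA ga -!mulrA -!geM mulgVK.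
  apply/asboolP; exists (MkA1 cC); apply/val_inj/val_inj => /=.
  by rewrite zE -[RHS](coboundary_ge h aU).
move=> /asboolP[c zc]; have cU := ugvalP (A1val c).
have [|h aE] := coboundary_inj aU cU; first by rewrite -zE -zc.
apply/InnP; exists h^-1%g => g; apply: (@ge_inj k); rewrite pE.
apply: (mulrI aU); rewrite !mulrA mulrV // mul1r aE mulrA -(cunitC c) -!mulrA -!geM.
by rewrite invgK !mulgA mulgV mul1g.
Qed.

(** Both [q p] and [q p'] correspond to the trivial twist, hence are inner, and
    [p^-1 p' = (q p)^-1 (q p')]. *)
Lemma twist_perm_uniq z p p' q : twist_perm z p -> twist_perm z p' ->
  twist_perm z^-1%g q -> (p^-1 * p')%g \in Inn gT.
Proof.
move=> zp zp' zV; have := twist_permM zV zp; have := twist_permM zV zp'.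
rewrite mulVg => /twist_perm_B2 i' /twist_perm_B2 i.
have B1 : 1%g \in B2 k gT by exact: (nsub_closed (B2 k gT)).1.
by rewrite -(mulKg q p') mulgA -invMg groupM ?groupV ?i ?i'.
Qed.

Hypothesis char_k : [pchar k] =i pred0.
Hypothesis Btriv : calB k gT = [set calB_one k gT]%classic.

Lemma invariant_twist_perm z : exists p, twist_perm z p.
Proof.
set F := ugval (Z2val z); have FU : F \is a GRing.unit := ugvalP _.
have [/is_twistE tw FC] := inv_twistP _ (Z2valP z).
have R1 : Rmat F = 1.
  apply: (R_trivial char_k) Btriv.
  - exact: Rmat_unit.
  - exact: Rmat_invariant.
  - exact: Rmat_swap.
  - exact: Rmat_id_Delta.
  - exact: Rmat_Delta_id.
  - exact: kappa_Rmat.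
have Fs : swap F = F by rewrite -[RHS]RmatE // R1 mulr1.
have [a aU FE] := symmetric_twist_coboundary FU FC tw Fs.
have na : normalizes (Ugroup aU).
  by apply/coboundary_invariant; rewrite -[coboundary _]FE.
have [_ n2] := (normalizesP _).1 na; have [p pE] := choice n2.
have pI : injective p.
  move=> x y pxy; apply: (@ge_inj k); apply: (mulIr aU).
  by apply: (mulrI (_ : a^-1 \is a GRing.unit)); rewrite ?unitrV // !mulrA !pE pxy.
by exists (perm pI), (Ugroup aU); split=> // g; rewrite permE pE.
Qed.

End Correspondence.

Theorem corollary4p7 (k : closedFieldType) (gT : finGroupType)
  (char_k : [pchar k]%R =i pred0)
  (calB_trivial : calB k gT = [set calB_one k gT]%classic) :
  group_iso (H2l k gT) [subg (Int_group k gT / Inn gT)%G].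
Proof.
have tp := invariant_twist_perm char_k calB_trivial.
(* The choice [P z] is arbitrary; [cosetE] shows that its class modulo [Inn] depends only on [z]. *)
have [P PE] := choice tp.
have Int_N p : p \in Int k gT -> p \in 'N(Inn gT)%g.
  exact: subsetP (normal_norm (Inn_normal_Int k gT)) p.
have PN z : P z \in 'N(Inn gT)%g by apply/Int_N/twist_perm_Int/PE.
have cosetE z p : twist_perm z p -> coset (Inn gT) (P z) = coset (Inn gT) p.
  move=> zp; have pN := Int_N _ (twist_perm_Int zp).
  apply/eqP; rewrite eq_sym eq_mulVg1 -morphV // -morphM ?groupV //.
  by apply/eqP/coset_id; exact: twist_perm_uniq zp (PE z) (PE z^-1%g).
have inQ z : coset (Inn gT) (P z) \in (Int_group k gT / Inn gT)%g.
  by apply: mem_quotient; apply/twist_perm_Int/PE.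
pose f z := subg (Int_group k gT / Inn gT)%G (coset (Inn gT) (P z)).
apply: (first_isomorphism (f := f)) => [z z'|z|y].
- rewrite /f -subgM //; congr subg.
  by rewrite -morphM // (cosetE _ _ (twist_permM (PE z) (PE z'))).
- rewrite -(twist_perm_B2 (PE z)); split=> [fz|Pz].
    by apply: coset_idr => //; rewrite -[LHS](@subgK _ _ _ (inQ z)) -/(f z) fz.
  by rewrite /f coset_id //; exact: morph1.
have /morphimP[p pN pI yE] := subgP y.
have [z zp] := twist_perm_surj pI; exists z.
by rewrite /f (cosetE _ _ zp) -yE sgvalK.
Qed.
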